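(* Let $G$ be a group of order at most $3$. Then the Euclidean contortion of $G$ is $$\Upsilon(G)=\begin{cases}1&\text{if }|G|=1,\\ \sqrt2&\text{if }|G|=2,\\ 3/2&\text{if }|G|=3.\end{cases}$$
   Context: For a map $f\colon X\to Y$ of metric spaces, let $\alpha,\beta\in[0,\infty]$ be the largest and smallest constants (respectively) with $\alpha\, d_X(x,x')\le d_Y(f(x),f(x'))\le\beta\, d_X(x,x')$ for all $x,x'\in X$; the distortion of $f$ is $\kappa(f):=\beta/\alpha$, with $\kappa(f)=\infty$ if $\alpha=0$ or $\beta=\infty$. The Euclidean distortion $c_2(X)\in[1,\infty]$ is the infimum of all $c$ for which there exist a Hilbert space $H$ and a map $f\colon X\to H$ with $\kappa(f)=c$ (a one-point space is a degenerate case, for which $c_2$ is taken to be $1$). If a group $G$ acts by isometries on a metric space $X$ with closed orbits, the orbit space $X/G$ carries the quotient metric $d([x],[y])=\inf_{p\in[x],\,q\in[y]}d_X(p,q)$, where $[x]=G\cdot x$. The Euclidean contortion of a finite group $G$ is $\Upsilon(G):=\sup_{V}c_2(V/G)$, where $V$ ranges over all (equivalence classes of) finite-dimensional real orthogonal representations of $G$. *)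

(* Defs.v *)
From HB Require Import structures.
From mathcomp Require Import all_boot all_order all_algebra all_fingroup.
From mathcomp Require Import sesquilinear mxrepresentation.
From mathcomp Require Import all_classical all_reals all_analysis.

Set Implicit Arguments.
Unset Strict Implicit.
Unset Printing Implicit Defensive.

Import Order.TTheory GRing.Theory Num.Theory.
Import numFieldNormedType.Exports.

Local Open Scope classical_set_scope.
Local Open Scope ring_scope.

(* The real inner product is the field [inner]. The [Metric] parent only names
   the distance: it is forced to be that of the norm, see [hilbert_mdistE]. *)
HB.mixin Record CompleteNormedModule_isHilbert (R : realType) H
    & CompleteNormedModule R H := {
  inner : {dot H for (@idfun R)} ;
  innerxx : forall x : H, inner x x = `|x| ^+ 2
}.

#[short(type="hilbertType")]
HB.structure Definition Hilbert (R : realType) :=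
  {H of CompleteNormedModule R H & Metric R H
      & CompleteNormedModule_isHilbert R H}.

Lemma hilbert_mdistE (R : realType) (H : hilbertType R) (x y : H) :
  mdist x y = `|x - y|.
Proof.
have E d : (mdist x y < d) = (`|x - y| < d).
  have := congr1 (fun f => f x d y) (@ball_normE R H).
  rewrite ballEmdist /ball_ /= => E; apply/idP/idP => h.
    by rewrite E.
  by rewrite -E.
apply/eqP; rewrite eq_le !leNgt; apply/andP; split.
  by rewrite -E ltxx.
by rewrite E ltxx.
Qed.

Section Distortion.
Context {R : realType}.
Local Open Scope ereal_scope.

(* With 0 * +oo = 0, the supremum and the infimum below are attained. *)
Definition lower_lipschitz (X Y : metricType R) (f : X -> Y) : \bar R :=
  ereal_sup [set a | 0 <= a /\ forall x x',
    a * (mdist x x')%:E <= (mdist (f x) (f x'))%:E].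

Definition upper_lipschitz (X Y : metricType R) (f : X -> Y) : \bar R :=
  ereal_inf [set b | 0 <= b /\ forall x x',
    (mdist (f x) (f x'))%:E <= b * (mdist x x')%:E].

Definition distortion (X Y : metricType R) (f : X -> Y) : \bar R :=
  if (lower_lipschitz f == 0) || (upper_lipschitz f == +oo) then +oo
  else upper_lipschitz f / lower_lipschitz f.

(* On a space with at most one point every map has [lower_lipschitz] +oo and
   [upper_lipschitz] 0, hence the separate case. *)
Definition euclidean_distortion (X : metricType R) : \bar R :=
  if `[< forall x y : X, x = y >] then 1
  else ereal_inf [set c | exists (H : hilbertType R) (f : X -> H),
                            distortion f = c].

End Distortion.

(* The canonical norm of ['rV[R]_n] is the sup norm, so the Euclidean distance
   is introduced separately. *)
Definition euclid_dist {R : realType} {n : nat} (u v : 'rV[R]_n) : R :=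
  Num.sqrt (\sum_(i < n) (u 0 i - v 0 i) ^+ 2).

Section EuclidDist.
Context {R : realType} {n : nat}.
Implicit Types u v w : 'rV[R]_n.

Lemma euclid_distxx u : euclid_dist u u = 0.
Proof.
by rewrite /euclid_dist big1 ?sqrtr0 // => i _; rewrite subrr expr0n.
Qed.

Lemma euclid_dist_ge0 u v : 0 <= euclid_dist u v.
Proof. exact: sqrtr_ge0. Qed.

Lemma euclid_dist_sym u v : euclid_dist u v = euclid_dist v u.
Proof.
by congr Num.sqrt; apply: eq_bigr => i _; rewrite -sqrrN opprB.
Qed.

Lemma euclid_dist_eq0 u v : euclid_dist u v = 0 -> u = v.
Proof.
move=> /eqP; rewrite sqrtr_eq0 => le0.
have /eqP : \sum_(i < n) (u 0 i - v 0 i) ^+ 2 = 0.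
  by apply/eqP; rewrite eq_le le0 sumr_ge0 // => i _; exact: sqr_ge0.
rewrite psumr_eq0 => [/allP uv|i _]; last exact: sqr_ge0.
apply/rowP => i; apply/eqP; rewrite -subr_eq0 -sqrf_eq0.
exact: (uv i (mem_index_enum i)).
Qed.

Lemma sum_cauchy_schwarz (a b : 'I_n -> R) :
  (\sum_i a i * b i) ^+ 2 <= (\sum_i a i ^+ 2) * (\sum_i b i ^+ 2).
Proof.
set A := \sum_i a i ^+ 2; set B := \sum_i b i ^+ 2; set C := \sum_i a i * b i.
have B0 : 0 <= B by apply: sumr_ge0 => i _; exact: sqr_ge0.
have : 0 <= \sum_i (B * a i - C * b i) ^+ 2.
  by apply: sumr_ge0 => i _; exact: sqr_ge0.
have -> : \sum_i (B * a i - C * b i) ^+ 2 = B * (A * B - C ^+ 2).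
  transitivity (\sum_i (B ^+ 2 * a i ^+ 2 - B * C *+ 2 * (a i * b i)
                         + C ^+ 2 * b i ^+ 2)).
    apply: eq_bigr => i _; rewrite sqrrB !exprMn; congr (_ - _ + _).
    by rewrite mulrnAl; congr (_ *+ 2); rewrite mulrACA.
  rewrite big_split sumrB /= -!mulr_sumr -/A -/B -/C.
  rewrite mulrBr mulrnAl -mulrA -expr2 mulr2n opprD (mulrC (C ^+ 2)).
  by rewrite addrA subrK expr2 -mulrA (mulrC B A).
move: B0; rewrite le_eqVlt => /predU1P[B0 _|B0]; last first.
  by rewrite pmulr_rge0 // subr_ge0.
have b0 i : b i = 0.
  move/esym/eqP: B0; rewrite psumr_eq0 => [/allP b0|j _]; last exact: sqr_ge0.
  by apply/eqP; rewrite -sqrf_eq0; exact: (b0 i (mem_index_enum i)).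
by rewrite /C big1 => [|i _]; rewrite ?b0 ?mulr0 // -B0 mulr0 expr0n.
Qed.

Lemma euclid_dist_triangle v u w :
  euclid_dist u w <= euclid_dist u v + euclid_dist v w.
Proof.
rewrite -[leRHS]ger0_norm ?addr_ge0 ?euclid_dist_ge0 // -sqrtr_sqr.
apply: ler_wsqrtr; rewrite sqrrD.
have S0 (x y : 'rV[R]_n) : 0 <= \sum_(i < n) (x 0 i - y 0 i) ^+ 2.
  by apply: sumr_ge0 => i _; exact: sqr_ge0.
rewrite !sqr_sqrtr // -sqrtrM //.
have -> : \sum_(i < n) (u 0 i - w 0 i) ^+ 2 =
    \sum_(i < n) (u 0 i - v 0 i) ^+ 2
    + (\sum_(i < n) (u 0 i - v 0 i) * (v 0 i - w 0 i)) *+ 2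
    + \sum_(i < n) (v 0 i - w 0 i) ^+ 2.
  rewrite -sumrMnl -!big_split /=; apply: eq_bigr => i _.
  by rewrite -sqrrD addrA subrK.
rewrite lerD2r lerD2l lerMn2r /=; apply: (le_trans (ler_norm _)).
by rewrite -sqrtr_sqr; apply: ler_wsqrtr; exact: sum_cauchy_schwarz.
Qed.

Lemma euclid_dist_orthogonal (M : 'M[R]_n) u v : M *m M^T = 1%:M ->
  euclid_dist (u *m M) (v *m M) = euclid_dist u v.
Proof.
move=> MM; congr Num.sqrt.
have E (x y : 'rV[R]_n) :
    \sum_(i < n) (x 0 i - y 0 i) ^+ 2 = ((x - y) *m (x - y)^T) 0 0.
  by rewrite mxE; apply: eq_bigr => i _; rewrite !mxE expr2.
by rewrite !E -mulmxBl trmx_mul mulmxA -(mulmxA _ M) MM mulmx1.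
Qed.

End EuclidDist.

(* An orthonormal basis makes every finite-dimensional real orthogonal
   representation equivalent to one of this form. [G] acts on row vectors by
   right multiplication, which does not affect the orbits. *)
Record orthogonal_repr (R : realType) (gT : finGroupType) (G : {group gT}) :=
  OrthogonalRepr {
    repr_dim : nat ;
    ortho_repr :> mx_representation R G repr_dim ;
    ortho_reprP : {in G, forall g, ortho_repr g *m (ortho_repr g)^T = 1%:M}
  }.

Section OrbitSpace.
Context {R : realType} {gT : finGroupType} {G : {group gT}}.
Variable V : orthogonal_repr R G.

Definition repr_orbit (x : 'rV[R]_(repr_dim V)) : set 'rV[R]_(repr_dim V) :=
  [set y | exists2 g, g \in G & y = x *m V g].

(* The points of the quotient V/G are the orbits themselves. *)
Definition orbit_space : Type := set_type (range repr_orbit).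

HB.instance Definition _ := Choice.on orbit_space.

Definition orbit_dist (A B : orbit_space) : R :=
  inf [set euclid_dist p q | p in val A & q in val B].

Let isom g x y : g \in G ->
  euclid_dist (x *m V g) (y *m V g) = euclid_dist x y.
Proof. by move=> Gg; apply: euclid_dist_orthogonal; exact: ortho_reprP. Qed.

Let orbit_spaceP (A : orbit_space) : exists x, val A = repr_orbit x.
Proof. by case: A => A /=; rewrite inE => -[x _ <-]; exists x. Qed.

Let orbit_mul (A : orbit_space) p g : val A p -> g \in G -> val A (p *m V g).
Proof.
have [x ->] := orbit_spaceP A => -[h Gh ->] Gg.
by exists (h * g)%g; rewrite ?groupM // repr_mxM // mulmxA.
Qed.

Let orbit_trans (A : orbit_space) p q : val A p -> val A q ->
  exists2 g, g \in G & q = p *m V g.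
Proof.
have [x ->] := orbit_spaceP A => -[h Gh ->] [k Gk ->].
by exists (h^-1 * k)%g; rewrite ?groupM ?groupV // repr_mxM ?groupV // mulmxA
  repr_mxK.
Qed.

Let orbit_dist_le (A B : orbit_space) p q : val A p -> val B q ->
  orbit_dist A B <= euclid_dist p q.
Proof.
move=> Ap Bq; apply: ge_inf; last by exists p => //; exists q.
by exists 0 => _ [a _ [b _ <-]]; exact: euclid_dist_ge0.
Qed.

Let orbit_dist_attained (A B : orbit_space) :
  exists p q, [/\ val A p, val B q & orbit_dist A B = euclid_dist p q].
Proof.
have [x Ax] := orbit_spaceP A; have [y By] := orbit_spaceP B.
have xA : val A x by rewrite Ax; exists 1%g; rewrite ?group1 // repr_mx1 mulmx1.
have yB : val B y by rewrite By; exists 1%g; rewrite ?group1 // repr_mx1 mulmx1.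
pose F g := euclid_dist x (y *m V g).
case: (arg_minP F (group1 G)) => g Gg gmin.
have Bg : val B (y *m V g) by exact: orbit_mul.
exists x, (y *m V g); split => //; apply/eqP; rewrite eq_le orbit_dist_le //=.
apply: lb_le_inf; first by exists (euclid_dist x y), x => //; exists y.
move=> _ [p Ap [q Bq <-]].
have [h Gh ->] := orbit_trans xA Ap; have [k Gk ->] := orbit_trans yB Bq.
rewrite -[leRHS](isom _ _ (groupVr Gh)) repr_mxK // -mulmxA -repr_mxM ?groupV //.
exact: (gmin _ (groupM Gk (groupVr Gh))).
Qed.

Let orbit_eq (A B : orbit_space) p : val A p -> val B p -> A = B.
Proof.
move=> Ap Bp; apply/val_inj/seteqP; split => q.
  by move=> Aq; have [g Gg ->] := orbit_trans Ap Aq; exact: orbit_mul.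
by move=> Bq; have [g Gg ->] := orbit_trans Bp Bq; exact: orbit_mul.
Qed.

Let orbit_distxx A : orbit_dist A A = 0.
Proof.
have [p [q [Ap Aq E]]] := orbit_dist_attained A A.
apply/eqP; rewrite eq_le; apply/andP; split; last by rewrite E euclid_dist_ge0.
by rewrite -(euclid_distxx p); exact: orbit_dist_le.
Qed.

Let orbit_dist_eq0 A B : orbit_dist A B = 0 -> A = B.
Proof.
have [p [q [Ap Bq ->]]] := orbit_dist_attained A B.
by move=> /euclid_dist_eq0 pq; apply: (orbit_eq Ap); rewrite pq.
Qed.

Let orbit_dist_sym A B : orbit_dist A B = orbit_dist B A.
Proof.
have le A' B' : orbit_dist A' B' <= orbit_dist B' A'.
  have [p [q [Bp Aq ->]]] := orbit_dist_attained B' A'.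
  by rewrite euclid_dist_sym; exact: orbit_dist_le.
by apply/eqP; rewrite eq_le !le.
Qed.

Let orbit_dist_triangle B A C :
  orbit_dist A C <= orbit_dist A B + orbit_dist B C.
Proof.
have [p [q [Ap Bq ->]]] := orbit_dist_attained A B.
have [s [r [Bs Cr ->]]] := orbit_dist_attained B C.
have [g Gg ->] := orbit_trans Bs Bq.
have Cg : val C (r *m V g) by exact: orbit_mul.
rewrite -[euclid_dist s r](isom _ _ Gg).
exact: le_trans (orbit_dist_le Ap Cg) (euclid_dist_triangle _ _ _).
Qed.

HB.instance Definition _ := @isMetric.Build R orbit_space orbit_dist
  orbit_distxx orbit_dist_eq0 orbit_dist_sym orbit_dist_triangle.

Lemma orbit_mdistE (A B : orbit_space) : mdist A B = orbit_dist A B.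
Proof. by []. Qed.

End OrbitSpace.

Definition euclidean_contortion (R : realType) (gT : finGroupType)
    (G : {group gT}) : \bar R :=
  ereal_sup [set euclidean_distortion (orbit_space V)
            | V in [set: orthogonal_repr R G]].
Arguments euclidean_contortion R {gT} G.

(* Main.v *)
Require Import Defs.
From HB Require Import structures.
From mathcomp Require Import all_boot all_order all_algebra all_fingroup.
From mathcomp Require Import sesquilinear mxrepresentation cyclic.
From mathcomp Require Import all_classical all_reals all_analysis.
From mathcomp Require Import ring lra.

Set Implicit Arguments.
Unset Strict Implicit.
Unset Printing Implicit Defensive.

Import Order.TTheory GRing.Theory Num.Theory.
Import numFieldNormedType.Exports.

Local Open Scope classical_set_scope.
Local Open Scope ring_scope.

(* For a finite orthogonal group G, split V into the fixed space and its
   orthogonal complement, with x0 and x1 the components of x.  The upper bound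
   comes from x |-> (x0, |x1| Phi(x1/|x1|)), where Phi takes G-averages of
   tensor powers and thus has as its kernel a combination of averages of
   <u, v g>^m: one takes <u, v>^2 for order 2 and, writing z for the hermitian
   product on the complement viewed as C^n, (3/4)|z|^2 + (1/4)Re z^3 for
   order 3.  Comparing the kernel with max_g <u, v g> and with <u, v> becomes
   an elementary polynomial inequality on the disc.
   The lower bound comes from G, of order r, rotating the plane.  An arc of
   angle 2 pi / r of the unit circle becomes a closed curve t |-> f(t) in the
   Hilbert space, and f(t + pi / r) - f(t) is antiperiodic; the discrete
   Wirtinger inequality bounds its size by that of its increments.  Letting the
   mesh tend to 0 gives distortion at least r sin(pi / (2 r)). *)

(** * Euclidean spaces as Hilbert spaces *)

(** A separate name that inherits only the module structure of finite functions, so that the norm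
    given to it below is the Euclidean one. *)
Definition l2 (R : realType) (I : finType) : Type := {ffun I -> R^o}.

Section L2.
Context {R : realType} {I : finType}.
Local Notation E := (l2 R I).
Implicit Types x y z : E.

HB.instance Definition _ := GRing.Lmodule.on E.

Definition l2_dot x y : R := \sum_i x i * y i.

Lemma l2_dotC x y : l2_dot x y = l2_dot y x.
Proof. by apply: eq_bigr => i _; rewrite mulrC. Qed.

Lemma l2_dotPl a x y z : l2_dot (a *: x + y) z = a * l2_dot x z + l2_dot y z.
Proof.
rewrite /l2_dot mulr_sumr -big_split/=; apply: eq_bigr => i _.
by rewrite !ffunE mulrDl mulrA.
Qed.

Lemma l2_dotxx_ge0 x : 0 <= l2_dot x x.
Proof. by apply: sumr_ge0 => i _; rewrite -expr2 sqr_ge0. Qed.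

Lemma l2_dotxx_eq0 x : l2_dot x x = 0 -> x = 0.
Proof.
move=> /eqP; rewrite psumr_eq0 => [/allP x0|i _]; last first.
  by rewrite -expr2 sqr_ge0.
apply/ffunP => i; rewrite ffunE; apply/eqP.
by have := x0 i (mem_index_enum i); rewrite /= mulf_eq0 orbb.
Qed.

Lemma l2_dot_bilinear : bilinear_for *%R (idfun \; *%R) l2_dot.
Proof.
split=> [x a y z|x a y z]; first exact: l2_dotPl.
by rewrite /= l2_dotC l2_dotPl !(l2_dotC x).
Qed.
HB.instance Definition _ :=
  bilinear_isBilinear.Build R E E R *%R (idfun \; *%R) l2_dot l2_dot_bilinear.

Lemma l2_dot_hermitian x y : l2_dot x y = (-1) ^+ false * idfun (l2_dot y x).
Proof. by rewrite expr0 mul1r /= l2_dotC. Qed.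
HB.instance Definition _ :=
  isHermitianSesquilinear.Build R E false idfun l2_dot l2_dot_hermitian.

Lemma l2_dot_gt0 x : x != 0 -> 0 < l2_dot x x.
Proof.
move=> x0; rewrite lt_neqAle l2_dotxx_ge0 andbT eq_sym.
by apply: contraNN x0 => /eqP/l2_dotxx_eq0/eqP.
Qed.
HB.instance Definition _ := isDotProduct.Build R E l2_dot l2_dot_gt0.

Definition l2_norm x : R := Num.sqrt (l2_dot x x).

Lemma l2_dot_scale (a b : R) x y :
  l2_dot (a *: x) (b *: y) = a * b * l2_dot x y.
Proof.
rewrite /l2_dot mulr_sumr; apply: eq_bigr => i _.
by rewrite !ffunE mulrACA.
Qed.

Lemma l2_dot_sqrD x y :
  l2_dot (x + y) (x + y) = l2_dot x x + l2_dot x y *+ 2 + l2_dot y y.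
Proof.
rewrite /l2_dot -sumrMnl -!big_split/=; apply: eq_bigr => i _.
by rewrite !ffunE -expr2 sqrrD !expr2.
Qed.

Lemma l2_cauchy_schwarz x y : l2_dot x y ^+ 2 <= l2_dot x x * l2_dot y y.
Proof.
rewrite /l2_dot !(reindex _ (onW_bij _ (@enum_val_bij I)))/=.
exact: sum_cauchy_schwarz.
Qed.

Lemma l2_normZ (a : R) x : l2_norm (a *: x) = `|a| * l2_norm x.
Proof.
by rewrite /l2_norm l2_dot_scale -expr2 sqrtrM ?sqr_ge0// sqrtr_sqr.
Qed.

Lemma l2_normD x y : l2_norm (x + y) <= l2_norm x + l2_norm y.
Proof.
rewrite -[leRHS]ger0_norm ?addr_ge0 ?sqrtr_ge0// -sqrtr_sqr ler_wsqrtr//.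
rewrite l2_dot_sqrD sqrrD !sqr_sqrtr ?l2_dotxx_ge0// lerD2r lerD2l.
rewrite lerMn2r/= (le_trans (ler_norm _))// -sqrtr_sqr.
by rewrite -sqrtrM ?l2_dotxx_ge0// ler_wsqrtr// l2_cauchy_schwarz.
Qed.

Lemma l2_norm_eq0 x : l2_norm x = 0 -> x = 0.
Proof.
move=> /eqP; rewrite sqrtr_eq0 => x0; apply: l2_dotxx_eq0.
by apply/eqP; rewrite eq_le x0 l2_dotxx_ge0.
Qed.

HB.instance Definition _ :=
  Lmodule_isNormed.Build R E l2_normD l2_normZ l2_norm_eq0.

Lemma l2_dotxx x : l2_dot x x = `|x| ^+ 2.
Proof. by rewrite [`|x|]/(l2_norm x) sqr_sqrtr// l2_dotxx_ge0. Qed.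

Lemma l2_coord_le x i : `|x i| <= `|x|.
Proof.
rewrite [leRHS]/(l2_norm x) -sqrtr_sqr ler_wsqrtr// /l2_dot (bigD1 i)//=.
by rewrite expr2 lerDl sumr_ge0// => j _; rewrite -expr2 sqr_ge0.
Qed.

Lemma l2_norm_le_coords x (e : R) : 0 <= e -> (forall i, `|x i| <= e) ->
  `|x| <= Num.sqrt #|I|%:R * e.
Proof.
move=> e0 xe; rewrite [leLHS]/(l2_norm x) -{1}(ger0_norm e0) -sqrtr_sqr.
rewrite -sqrtrM// ler_wsqrtr// mulr_natl -sumr_const ler_sum// => i _.
by rewrite -expr2 -ler_sqrt ?sqr_ge0// !sqrtr_sqr (ger0_norm e0).
Qed.

(** Coordinates are 1-Lipschitz, so each coordinate filter is Cauchy and converges in [R]; finitely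
    many coordinates control the norm, so the vector of limits is the limit. *)
Lemma l2_complete (F : set_system E) : ProperFilter F -> cauchy F -> cvg F.
Proof.
move=> FF Fc.
have Fi (i : I) : cauchy ((fun x : E => x i : R^o) @ F).
  apply: cauchy_exP => e e0.
  have /cauchyP/(_ e e0)[x Fx] := Fc; exists (x i).
  suff : F [set y : E | ball (x i : R^o) e (y i)] by [].
  apply: filterS Fx => y; rewrite -!ball_normE/=; apply: le_lt_trans.
  by have := l2_coord_le (x - y) i; rewrite !ffunE.
pose l : E := [ffun i => lim ((fun x : E => x i : R^o) @ F)].
apply/cvg_ex; exists l; apply/cvgrPdist_le => e e0.
set c := Num.sqrt #|I|%:R : R.
(* The [+ 1] keeps the divisor positive when [I] is empty. *)
have c0 : 0 < c + 1 by rewrite ltr_wpDl ?sqrtr_ge0.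
have d0 : 0 < e / (c + 1) by rewrite divr_gt0.
near=> x.
have xl (i : I) : `|(l - x) i| <= e / (c + 1).
  rewrite !ffunE; move: i; near: x; apply: filter_forall => i.
  by have /cauchy_cvgP/cvgrPdist_le/(_ _ d0) := Fi i.
rewrite (le_trans (l2_norm_le_coords (ltW d0) xl))//.
by rewrite mulrCA ler_piMr ?ltW// ltr_pdivrMr// mul1r ltrDl.
Unshelve. all: by end_near. Qed.

HB.instance Definition _ := Uniform_isComplete.Build E l2_complete.

Lemma l2_dist_eq0 x y : `|x - y| = 0 -> x = y.
Proof. by move/eqP; rewrite normr_eq0 subr_eq0 => /eqP. Qed.

Lemma l2_ballE x (e : R) : ball x e = [set y | `|x - y| < e].
Proof. by rewrite -ball_normE. Qed.

HB.instance Definition _ := PseudoMetric_isMetric.Build R E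
  (fun x y => normr_ge0 (x - y)) l2_dist_eq0 l2_ballE.

HB.instance Definition _ :=
  CompleteNormedModule_isHilbert.Build R E l2_dotxx.

End L2.

(** * The discrete Wirtinger inequality *)

Section Inner.
Context {R : realType} {H : hilbertType R}.
Implicit Types x y z : H.

Lemma innerC x y : inner x y = inner y x.
Proof. by rewrite (hermitian_subproof x y) expr0 mul1r. Qed.

Lemma innerPr (a : R) x y z : inner z (a *: x + y) = a * inner z x + inner z y.
Proof. by rewrite linearP. Qed.

Lemma innerPl (a : R) x y z : inner (a *: x + y) z = a * inner x z + inner y z.
Proof. by rewrite innerC innerPr !(innerC z). Qed.

Lemma normD3_sqr (a b c : R) x y z :
  `|a *: x + (b *: y + c *: z)| ^+ 2 =
  a ^+ 2 * `|x| ^+ 2 + b ^+ 2 * `|y| ^+ 2 + c ^+ 2 * `|z| ^+ 2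
  + 2 * (a * b * inner x y + a * c * inner x z + b * c * inner y z).
Proof.
have Zr (u v : H) (d : R) : inner u (d *: v) = d * inner u v by rewrite linearZ.
have Zl (u v : H) (d : R) : inner (d *: v) u = d * inner v u.
  by rewrite innerC Zr innerC.
rewrite -!innerxx !(innerPl, innerPr, Zr, Zl).
rewrite (innerC y x) (innerC z x) (innerC z y).
ring.
Qed.

Lemma normB_sqr x y :
  `|x - y| ^+ 2 = `|x| ^+ 2 + `|y| ^+ 2 - 2 * inner x y.
Proof.
have := normD3_sqr 1 (-1) 0 x y 0.
by rewrite scale1r scaleN1r scaler0 addr0 => ->; ring.
Qed.

Lemma normD_sqr x y :
  `|x + y| ^+ 2 = `|x| ^+ 2 + `|y| ^+ 2 + 2 * inner x y.
Proof.
have := normD3_sqr 1 1 0 x y 0.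
by rewrite !scale1r scaler0 addr0 => ->; ring.
Qed.

End Inner.

Lemma l2_dist_sqr (R : realType) (I : finType) (x y : l2 R I) :
  `|x - y| ^+ 2 = l2_dot x x + l2_dot y y - 2 * l2_dot x y.
Proof. by rewrite normB_sqr !l2_dotxx. Qed.

Section Wirtinger.
Context {R : realType} {H : hilbertType R}.

(* The left-hand side is the minimum of the right-hand one over all paths with
   the same endpoints; the induction step completes a square. *)
Lemma wirtinger_open (d : R) (g : nat -> H) (k : nat) :
  (forall i, (0 < i <= k.+1)%N -> 0 < sin (i%:R * d)) ->
  sin d / sin (k.+1%:R * d) *
    (cos (k.+1%:R * d) * (`|g 0%N| ^+ 2 + `|g k.+1| ^+ 2)
     - 2 * inner (g 0%N) (g k.+1)) <=
  \sum_(i < k.+1) (cos d * (`|g i| ^+ 2 + `|g i.+1| ^+ 2)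
                   - 2 * inner (g i) (g i.+1)).
Proof.
elim: k => [|k IH] s_gt0.
  rewrite big_ord1 mul1r divff ?mul1r// gt_eqF//.
  by have := s_gt0 1%N isT; rewrite mul1r.
rewrite big_ord_recr/= -lerBlDr; apply: le_trans (IH _); last first.
  by move=> i /andP[i0 ik]; rewrite s_gt0// i0 ltnW.
have := s_gt0 k.+1; rewrite leqnSn => /(_ isT).
have := s_gt0 k.+2; rewrite leqnn => /(_ isT).
have sS : sin (k.+2%:R * d) =
    sin (k.+1%:R * d) * cos d + cos (k.+1%:R * d) * sin d.
  by rewrite -sinD -{3}(mul1r d) -mulrDl natr1.
have cS : cos (k.+2%:R * d) =
    cos (k.+1%:R * d) * cos d - sin (k.+1%:R * d) * sin d.
  by rewrite -cosD -{3}(mul1r d) -mulrDl natr1.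
have := cos2Dsin2 (k.+1%:R * d); have := cos2Dsin2 d.
move: sS cS (g 0%N) (g k.+1) (g k.+2).
set s' := sin (k.+2%:R * d); set c' := cos (k.+2%:R * d).
set s := sin (k.+1%:R * d); set c := cos (k.+1%:R * d).
set sd := sin d; set cd := cos d => sS cS x y z d1 k1 s'0 s0.
rewrite -subr_ge0.
(* The difference of the two sides is this square over [s * s']. It vanishes exactly when [y] is the
   value at index [k.+1] of the path from [x] to [z] that solves g (i - 1) + g (i + 1) = 2 cos d g
   i. *)
have : 0 <= `|sd *: x + (- s' *: y + s *: z)| ^+ 2 / (s * s').
  by rewrite divr_ge0 ?sqr_ge0// mulr_ge0 ?ltW.
congr (_ <= _); rewrite normD3_sqr.
have e1 : c * s' - c' * s = sd.
  rewrite sS cS -[RHS]mul1r -k1; ring.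
have e2 : sd * c + cd * s = s' by rewrite sS; ring.
have e3 : cd * s' - sd * c' = s by rewrite sS cS -[RHS]mul1r -d1; ring.
have s_ne0 : s != 0 by rewrite gt_eqF.
have s'_ne0 : s' != 0 by rewrite gt_eqF.
move: (inner x y) (inner x z) (inner y z) (`|x| ^+ 2) (`|y| ^+ 2) (`|z| ^+ 2).
move=> xy xz yz xx yy zz.
transitivity (sd * (c * s' - c' * s) / (s * s') * xx
  + (sd * c + cd * s) / s * yy + (cd * s' - sd * c') / s' * zz
  + 2 * (sd * xz / s' - sd * xy / s - yz)).
  by rewrite e1 e2 e3; field; rewrite s_ne0 s'_ne0.
by field; rewrite s_ne0 s'_ne0.
Qed.

(* The closing edge, from [g k.+1] to [- g 0], has exactly the opposite of the
   minimum in [wirtinger_open]. *)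
Lemma wirtinger_antiperiodic (m : nat) (g : nat -> H) (a b : R) :
  (2 <= m)%N -> g m = - g 0%N ->
  (forall i, (i <= m)%N -> a <= `|g i| ^+ 2) ->
  (forall i, (i < m)%N -> `|g i.+1 - g i| ^+ 2 <= b) ->
  2 * (1 - cos (pi / m%:R)) * a <= b.
Proof.
case: m => [|[|k]]// _ gm ga gb.
set m := k.+2 in gm ga gb *; set d := pi / m%:R.
have md : m%:R * d = pi by rewrite mulrC divfK// pnatr_eq0.
have d0 : 0 < d by rewrite divr_gt0// pi_gt0.
have kd : k.+1%:R * d = pi - d.
  by rewrite -md /m -(natr1 k.+1) mulrDl mul1r addrK.
have s_gt0 i : (0 < i <= k.+1)%N -> 0 < sin (i%:R * d).
  move=> /andP[i0 ik]; rewrite sin_gt0_pi// mulr_gt0 ?ltr0n//=.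
  by rewrite -md ltr_pM2r// ltr_nat.
have := wirtinger_open g s_gt0; rewrite kd.
have cdE : cos (pi - d) = - cos d by rewrite addrC cosDpi cosN.
have sdE : sin (pi - d) = sin d by rewrite addrC sinDpi sinN opprK.
rewrite cdE sdE divff ?mul1r; last first.
  by rewrite gt_eqF//; have := s_gt0 1%N isT; rewrite mul1r.
move=> le0.
have {le0} sum_ge0 : 0 <= \sum_(i < m) (cos d * (`|g i| ^+ 2 + `|g i.+1| ^+ 2)
                   - 2 * inner (g i) (g i.+1)).
  rewrite big_ord_recr/= -/m gm normrN linearN/= (innerC (g k.+1)).
  rewrite -lerBlDr; apply: le_trans le0.
  by rewrite le_eqVlt; apply/orP; left; apply/eqP; ring.
have : \sum_(i < m) 2 * (1 - cos d) * a <= \sum_(i < m) b.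
  (* Each summand here equals (1 - cos d)(|g i|^2 + |g i.+1|^2), which is at least 2 (1 - cos d)
     a. *)
  apply: (@le_trans _ _ (\sum_(i < m) (`|g i.+1 - g i| ^+ 2 -
    (cos d * (`|g i| ^+ 2 + `|g i.+1| ^+ 2) - 2 * inner (g i) (g i.+1))))).
    apply: ler_sum => i _; rewrite normB_sqr (innerC (g i.+1)).
    have := ga i (ltnW (ltn_ord i)); have := ga i.+1 (ltn_ord i).
    have : 0 <= 1 - cos d by rewrite subr_ge0 cos_le1.
    move: (`|g i| ^+ 2) (`|g i.+1| ^+ 2) (inner _ _) => u v w c0 va ua.
    have : 0 <= (1 - cos d) * ((u - a) + (v - a)).
      by rewrite mulr_ge0// addr_ge0// subr_ge0.
    by rewrite -subr_ge0 => /le_trans; apply; rewrite le_eqVlt; apply/orP;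
      left; apply/eqP; ring.
  rewrite sumrB (@le_trans _ _ (\sum_(i < m) `|g i.+1 - g i| ^+ 2))//.
    by rewrite gerBl.
  by apply: ler_sum => i _; exact: gb.
by rewrite !sumr_const card_ord lerMn2r.
Qed.

End Wirtinger.

(** * Distortion *)

Section EuclideanDistortion.
Context {R : realType}.
Local Open Scope ereal_scope.

Lemma lower_lipschitzP (X Y : metricType R) (f : X -> Y) x x' :
  lower_lipschitz f * (mdist x x')%:E <= (mdist (f x) (f x'))%:E.
Proof.
have [->|xx'] := eqVneq x x'; first by rewrite mdistxx mule0 lee_fin mdist_ge0.
have d_gt0 : (0 < mdist x x')%R by rewrite mdist_gt0.
rewrite -lee_pdivlMr//; apply: ge_ereal_sup => a [_ /(_ x x')].
by rewrite -lee_pdivlMr.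
Qed.

Lemma upper_lipschitzP (X Y : metricType R) (f : X -> Y) x x' :
  (mdist (f x) (f x'))%:E <= upper_lipschitz f * (mdist x x')%:E.
Proof.
have [->|xx'] := eqVneq x x'; first by rewrite !mdistxx mule0.
have d_gt0 : (0 < mdist x x')%R by rewrite mdist_gt0.
rewrite -lee_pdivrMr//; apply: le_ereal_inf_tmp => b [_ /(_ x x')].
by rewrite -lee_pdivrMr.
Qed.

(** Both Lipschitz constants are attained, so they may serve as [a] and [b] themselves. Two distinct
    points rule out an infinite lower constant. *)
Lemma distortion_ge (X Y : metricType R) (f : X -> Y) (c : R) :
  (exists x y : X, x <> y) ->
  (forall a b : R, (0 < a)%R ->
    (forall x x', a * mdist x x' <= mdist (f x) (f x'))%R ->
    (forall x x', mdist (f x) (f x') <= b * mdist x x')%R -> (c * a <= b)%R) ->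
  c%:E <= distortion f.
Proof.
move=> [x [y xy]] cab; rewrite /distortion; case: ifPn; first by rewrite leey.
rewrite negb_or => /andP[l0 uoo].
have lP := lower_lipschitzP f; have uP := upper_lipschitzP f.
have : 0 <= lower_lipschitz f.
  by apply: ereal_sup_ubound; split=> // z t; rewrite mul0e lee_fin mdist_ge0.
have : 0 <= upper_lipschitz f by apply: le_ereal_inf_tmp => b [].
have d_gt0 : (0 < mdist x y)%R by rewrite mdist_gt0; exact/eqP.
move: (lower_lipschitz f) (upper_lipschitz f) l0 uoo lP uP.
move=> [a| |] [b| |]// a0 _ lP uP b_ge0 a_ge0.
  have {a0}a_gt0 : (0 < a)%R.
    by rewrite lt_neqAle eq_sym -lee_fin a_ge0 andbT -eqe.
  by rewrite inver gt_eqF// -EFinM lee_fin ler_pdivlMr//; exact: cab.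
by have := lP x y; rewrite gt0_mulye// leye_eq.
Qed.

Lemma euclidean_distortion_ge (X : metricType R) (c : R) :
  (exists x y : X, x <> y) ->
  (forall (H : hilbertType R) (f : X -> H) (a b : R), (0 < a)%R ->
    (forall x x', a * mdist x x' <= `|f x - f x'|)%R ->
    (forall x x', `|f x - f x'| <= b * mdist x x')%R -> (c * a <= b)%R) ->
  c%:E <= euclidean_distortion X.
Proof.
move=> [x [y xy]] cab; rewrite /euclidean_distortion.
case: asboolP => [/(_ x y)//|_].
apply: le_ereal_inf_tmp => _ [H [f <-]]; apply: distortion_ge.
  by exists x, y.
by move=> a b a0 af fb; apply: (cab H f) => // z t; rewrite -hilbert_mdistE.
Qed.

Lemma euclidean_distortion_le (X : metricType R) (H : hilbertType R)
    (f : X -> H) (c : R) : (1 <= c)%R ->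
  (forall x x', mdist x x' <= `|f x - f x'| <= c * mdist x x')%R ->
  euclidean_distortion X <= c%:E.
Proof.
move=> c1 fP; rewrite /euclidean_distortion; case: asboolP => [_|].
  by rewrite lee_fin.
move=> /existsNP[x /existsNP[y xy]].
apply: ge_ereal_inf; exists (distortion f); first by exists H, f.
have l1 : 1 <= lower_lipschitz f.
  apply: ereal_sup_ubound; split=> // z t.
  by rewrite mul1e lee_fin hilbert_mdistE; case/andP: (fP z t).
have uc : upper_lipschitz f <= c%:E.
  apply: ereal_inf_lbound; split=> [|z t].
    by rewrite lee_fin (le_trans _ c1).
  by rewrite lee_fin hilbert_mdistE; case/andP: (fP z t).
rewrite /distortion; case: ifPn => [/orP[|]/eqP E|_].
- by move: l1; rewrite E lee_fin ler10.
- by move: uc; rewrite E leye_eq.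
have d_gt0 : (0 < mdist x y)%R by rewrite mdist_gt0; exact/eqP.
have := lower_lipschitzP f x y.
move: (lower_lipschitz f) l1 => [a| |]//; last by rewrite gt0_mulye// leye_eq.
rewrite lee_fin => a1 _.
have a0 : (0 < a)%R by exact: lt_le_trans a1.
rewrite inver gt_eqF// lee_pdivrMr// (le_trans uc)// -EFinM lee_fin.
by rewrite ler_peMr// (le_trans _ c1).
Qed.

End EuclideanDistortion.

(** * Distances between orbits and invariant maps *)

Section OrbitSpace.
Context {R : realType} {gT : finGroupType} {G : {group gT}}.
Variable V : orthogonal_repr R G.
Local Notation n := (repr_dim V).
Implicit Types x y u v : 'rV[R]_n.

Definition orbit_of x : orbit_space V :=
  SigSub (mem_set (imageT (@repr_orbit R gT G V) x)).

Lemma orbit_ofP (A : orbit_space V) : exists x, A = orbit_of x.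
Proof.
case: A => A AV; have [x _ xA] := set_mem AV.
by exists x; apply: val_inj; rewrite /= xA.
Qed.

Lemma mdist_orbit_le x y g h : g \in G -> h \in G ->
  mdist (orbit_of x) (orbit_of y) <= euclid_dist (x *m V g) (y *m V h).
Proof.
move=> Gg Gh; rewrite orbit_mdistE; apply: ge_inf.
  by exists 0 => _ [a _ [b _ <-]]; exact: euclid_dist_ge0.
by exists (x *m V g); [exists g|exists (y *m V h) => //; exists h].
Qed.

(** The action is isometric, so only one of the two points has to run through its orbit. *)
Lemma mdist_orbit_ge x y (d : R) :
  (forall g, g \in G -> d <= euclid_dist x (y *m V g)) ->
  d <= mdist (orbit_of x) (orbit_of y).
Proof.
move=> dxy; rewrite orbit_mdistE; apply: lb_le_inf.
  exists (euclid_dist (x *m V 1%g) (y *m V 1%g)).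
  by exists (x *m V 1%g); [exists 1%g|exists (y *m V 1%g) => //; exists 1%g].
move=> _ [_ [g Gg ->] [_ [h Gh ->] <-]].
have -> : y *m V h = y *m V (h * g^-1)%g *m V g.
  by rewrite -mulmxA -repr_mxM ?groupM ?groupV// mulgKV.
by rewrite euclid_dist_orthogonal ?ortho_reprP// dxy// groupM ?groupV.
Qed.

(** Being invariant, [F] descends to the orbit space through any choice [rep] of representatives.
    For the lower bound one good [g] suffices, as the orbit distance is an infimum; for the upper
    bound invariance absorbs the minimising [g]. *)
Lemma orbit_distortion_le (H : hilbertType R) (F : 'rV[R]_n -> H) (c : R) :
  1 <= c ->
  (forall x g, g \in G -> F (x *m V g) = F x) ->
  (forall x y, exists2 g, g \in G & euclid_dist x (y *m V g) <= `|F x - F y|) ->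
  (forall x y, `|F x - F y| <= c * euclid_dist x y) ->
  (euclidean_distortion (orbit_space V) <= c%:E)%E.
Proof.
move=> c1 FG Fge Fle; pose rep A := projT1 (cid (orbit_ofP A)).
have repE A : orbit_of (rep A) = A by rewrite /rep; case: cid.
apply: (euclidean_distortion_le (f := F \o rep)) => // A B; apply/andP; split.
  rewrite -{1}(repE A) -{1}(repE B); have [g Gg] := Fge (rep A) (rep B).
  apply: le_trans; have := mdist_orbit_le (rep A) (rep B) (group1 G) Gg.
  by rewrite repr_mx1 mulmx1.
rewrite mulrC -ler_pdivrMr ?(lt_le_trans _ c1)//.
rewrite -{2}(repE A) -{2}(repE B); apply: mdist_orbit_ge => g Gg /=.
rewrite ler_pdivrMr ?(lt_le_trans _ c1)// mulrC.
by rewrite -(FG (rep B) g Gg) Fle.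
Qed.

End OrbitSpace.

(** * Averaged tensor powers *)

Section DotProduct.
Context {R : realType} {n : nat}.
Implicit Types u v w : 'rV[R]_n.

Definition dotv u v : R := \sum_i u 0 i * v 0 i.

Lemma dotvE u v : dotv u v = (u *m v^T) 0 0.
Proof. by rewrite mxE; apply: eq_bigr => i _; rewrite mxE. Qed.

Lemma dotvC u v : dotv u v = dotv v u.
Proof. by apply: eq_bigr => i _; rewrite mulrC. Qed.

Lemma dotvZl a u v : dotv (a *: u) v = a * dotv u v.
Proof. by rewrite !dotvE -scalemxAl mxE. Qed.

Lemma dotvDl u v w : dotv (u + v) w = dotv u w + dotv v w.
Proof. by rewrite !dotvE mulmxDl mxE. Qed.

Lemma dotvZr a u v : dotv u (a *: v) = a * dotv u v.
Proof. by rewrite dotvC dotvZl dotvC. Qed.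

Lemma dotvDr u v w : dotv w (u + v) = dotv w u + dotv w v.
Proof. by rewrite dotvC dotvDl !(dotvC w). Qed.

Lemma dotvNl u v : dotv (- u) v = - dotv u v.
Proof. by rewrite -scaleN1r dotvZl mulN1r. Qed.

Lemma dotvNr u v : dotv v (- u) = - dotv v u.
Proof. by rewrite dotvC dotvNl dotvC. Qed.

Lemma dotv0l v : dotv 0 v = 0.
Proof. by rewrite -(scale0r 0) dotvZl mul0r. Qed.

Lemma dotv_ge0 v : 0 <= dotv v v.
Proof. by apply: sumr_ge0 => i _; rewrite -expr2 sqr_ge0. Qed.

Lemma dotv_adj u v (M : 'M[R]_n) : dotv (u *m M) v = dotv u (v *m M^T).
Proof. by rewrite !dotvE trmx_mul trmxK mulmxA. Qed.

Lemma dotv_cauchy_schwarz u v : dotv u v ^+ 2 <= dotv u u * dotv v v.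
Proof. exact: sum_cauchy_schwarz. Qed.

Lemma euclid_dist_sqr u v : euclid_dist u v ^+ 2 = dotv (u - v) (u - v).
Proof.
rewrite sqr_sqrtr; last by apply: sumr_ge0 => i _; exact: sqr_ge0.
by apply: eq_bigr => i _; rewrite !mxE expr2.
Qed.

Lemma dotvBB u v :
  dotv (u - v) (u - v) = dotv u u + dotv v v - 2 * dotv u v.
Proof.
rewrite !(dotvDl, dotvDr, dotvNl, dotvNr) (dotvC v u); ring.
Qed.

(** Coordinates of the m-th tensor power of [u] in the standard basis, indexed by multi-indices
    [f]. *)
Definition tensor_power m u : {ffun {ffun 'I_m -> 'I_n} -> R} :=
  [ffun f : {ffun 'I_m -> 'I_n} => \prod_p u 0 (f p)].

Lemma tensor_power_dot m u v :
  \sum_f tensor_power m u f * tensor_power m v f = dotv u v ^+ m.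
Proof.
transitivity (\prod_(p < m) dotv u v); last by rewrite prodr_const card_ord.
rewrite bigA_distr_bigA/=.
by apply: eq_bigr => f _; rewrite !ffunE big_split.
Qed.

End DotProduct.

(** * Averages over the group and the fixed subspace *)

Section GroupAverage.
Context {R : realType} {gT : finGroupType} {G : {group gT}}.
Variable V : orthogonal_repr R G.
Local Notation n := (repr_dim V).
Implicit Types x y u v : 'rV[R]_n.

Lemma card_group_neq0 : #|G|%:R != 0 :> R.
Proof. by rewrite pnatr_eq0 -lt0n cardG_gt0. Qed.

Lemma repr_tr g : g \in G -> (V g)^T = V g^-1%g.
Proof.
move=> Gg; rewrite -[LHS]mul1mx -(repr_mx1 (ortho_repr V)) -(mulVg g).
by rewrite repr_mxM ?groupV// -mulmxA ortho_reprP// mulmx1.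
Qed.

Lemma dotv_repr u v g : g \in G -> dotv (u *m V g) (v *m V g) = dotv u v.
Proof.
by move=> Gg; rewrite dotv_adj -mulmxA ortho_reprP// mulmx1.
Qed.

Definition group_avg (T : lmodType R) (f : gT -> T) : T :=
  #|G|%:R^-1 *: \sum_(g in G) f g.

Lemma group_avgMr (T : lmodType R) (f : gT -> T) h : h \in G ->
  group_avg (fun g => f (g * h)%g) = group_avg f.
Proof.
move=> Gh; congr (_ *: _); rewrite [RHS](reindex_inj (mulIg h))/=.
by apply: eq_bigl => g; rewrite groupMr.
Qed.

Lemma group_avgMl (T : lmodType R) (f : gT -> T) h : h \in G ->
  group_avg (fun g => f (h * g)%g) = group_avg f.
Proof.
move=> Gh; congr (_ *: _); rewrite [RHS](reindex_inj (mulgI h))/=.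
by apply: eq_bigl => g; rewrite groupMl.
Qed.

Lemma group_avgV (T : lmodType R) (f : gT -> T) :
  group_avg (fun g => f g^-1%g) = group_avg f.
Proof.
congr (_ *: _); rewrite [RHS](reindex_inj invg_inj)/=.
by apply: eq_bigl => g; rewrite groupV.
Qed.

Lemma group_avg_cst (T : lmodType R) (c : T) : group_avg (fun=> c) = c.
Proof.
rewrite /group_avg sumr_const -[c *+ _]scaler_nat.
rewrite scalerA mulVf ?scale1r//.
exact: card_group_neq0.
Qed.

Lemma eq_group_avg (T : lmodType R) (f f' : gT -> T) :
  {in G, f =1 f'} -> group_avg f = group_avg f'.
Proof. by move=> ff'; congr (_ *: _); exact: eq_bigr. Qed.

(** The orthogonal projection onto the fixed vectors: it is symmetric and idempotent, as shown
    below. *)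
Definition fixed_proj : 'M[R]_n := group_avg (fun g => V g).

Lemma fixed_projM g : g \in G -> fixed_proj *m V g = fixed_proj.
Proof.
move=> Gg; rewrite -[RHS](group_avgMr _ Gg) /fixed_proj /group_avg.
rewrite -scalemxAl mulmx_suml; congr (_ *: _); apply: eq_bigr => h Gh.
by rewrite repr_mxM.
Qed.

Lemma fixed_proj_tr : fixed_proj^T = fixed_proj.
Proof.
rewrite -[RHS](group_avgV _) /fixed_proj /group_avg linearZ linear_sum/=.
by congr (_ *: _); apply: eq_bigr => g Gg; rewrite repr_tr.
Qed.

Lemma fixed_projMl g : g \in G -> V g *m fixed_proj = fixed_proj.
Proof.
move=> Gg; rewrite -fixed_proj_tr -{1}(trmxK (V g)) -trmx_mul repr_tr//.
by rewrite fixed_projM// groupV.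
Qed.

Lemma fixed_proj_id : fixed_proj *m fixed_proj = fixed_proj.
Proof.
rewrite {2}/fixed_proj /group_avg -scalemxAr mulmx_sumr.
under eq_bigr do rewrite fixed_projM//.
exact: group_avg_cst.
Qed.

Definition fixed_part x := x *m fixed_proj.
(** The component orthogonal to the fixed vectors; the name does not claim that the action there is
    free. *)
Definition free_part x := x - fixed_part x.

Lemma fixed_part_free x : fixed_part (free_part x) = 0.
Proof.
by rewrite /fixed_part mulmxBl /fixed_part -mulmxA fixed_proj_id subrr.
Qed.

Lemma fixed_part_repr x g : g \in G -> fixed_part (x *m V g) = fixed_part x.
Proof. by move=> Gg; rewrite /fixed_part -mulmxA fixed_projMl. Qed.

Lemma free_part_repr x g : g \in G -> free_part (x *m V g) = free_part x *m V g.
Proof.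
move=> Gg; rewrite /free_part fixed_part_repr// mulmxBl /fixed_part -mulmxA.
by rewrite fixed_projM.
Qed.

Lemma dotv_fixed_free x y : fixed_part y = 0 -> dotv (fixed_part x) y = 0.
Proof.
move=> y0; rewrite dotv_adj fixed_proj_tr -/(fixed_part y) y0.
by rewrite dotvC dotv0l.
Qed.

Lemma dotv_decomp x y : dotv x y =
  dotv (fixed_part x) (fixed_part y) + dotv (free_part x) (free_part y).
Proof.
have xE z : z = free_part z + fixed_part z by rewrite subrK.
rewrite {1}(xE x) {1}(xE y) dotvDl.
rewrite (dotvDr _ _ (free_part x)) (dotvDr _ _ (fixed_part x)).
rewrite (dotv_fixed_free x (fixed_part_free y)) (dotvC (free_part x)).
rewrite (dotvC _ (fixed_part y)) (dotv_fixed_free y (fixed_part_free x)).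
by rewrite addr0 add0r addrC dotvC.
Qed.

Lemma euclid_dist_decomp x y : euclid_dist x y ^+ 2 =
  euclid_dist (fixed_part x) (fixed_part y) ^+ 2
  + (dotv (free_part x) (free_part x) + dotv (free_part y) (free_part y)
     - 2 * dotv (free_part x) (free_part y)).
Proof.
rewrite !euclid_dist_sqr dotv_decomp; congr (_ + _).
  by rewrite /fixed_part -mulmxBl.
rewrite -dotvBB; congr (dotv _ _); rewrite /free_part /fixed_part mulmxBl;
  by rewrite opprD addrACA -opprD.
Qed.

(** The projection of the tensor power of [u] to the invariant tensors. *)
Definition avg_tensor m u : {ffun {ffun 'I_m -> 'I_n} -> R^o} :=
  group_avg (fun g => tensor_power m (u *m V g) : {ffun _ -> R^o}).

Lemma avg_tensor_repr m u g : g \in G ->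
  avg_tensor m (u *m V g) = avg_tensor m u.
Proof.
move=> Gg; rewrite -[RHS](group_avgMl _ Gg); apply: eq_group_avg => h Gh.
by rewrite repr_mxM// mulmxA.
Qed.

Lemma group_avgE (f : gT -> R^o) :
  group_avg f = #|G|%:R^-1 * \sum_(g in G) f g.
Proof. by []. Qed.

Lemma avg_tensorE m u f : avg_tensor m u f =
  #|G|%:R^-1 * \sum_(g in G) tensor_power m (u *m V g) f.
Proof. by rewrite /avg_tensor /group_avg !ffunE sum_ffunE. Qed.

(** The left side is a double average of <u h, v g>^m. Replacing [g] by [g * h] removes [h], so the
    average over [h] is that of a constant. *)
Lemma avg_tensor_dot m u v : \sum_f avg_tensor m u f * avg_tensor m v f =
  group_avg (fun g => dotv u (v *m V g) ^+ m : R^o).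
Proof.
transitivity (group_avg (fun h => group_avg (fun g =>
    dotv (u *m V h) (v *m V g) ^+ m : R^o))).
  rewrite !group_avgE mulr_sumr.
  under eq_bigr do rewrite !avg_tensorE mulrACA mulr_suml mulr_sumr.
  rewrite exchange_big/=; apply: eq_bigr => h Gh; rewrite group_avgE.
  under eq_bigr do rewrite mulr_sumr mulr_sumr.
  rewrite exchange_big/= mulr_sumr mulr_sumr; apply: eq_bigr => g Gg.
  rewrite -tensor_power_dot !mulr_sumr; apply: eq_bigr => f _.
  by rewrite -mulrA.
rewrite -[RHS]group_avg_cst; apply: eq_group_avg => h Gh.
rewrite -[LHS](group_avgMr _ Gh); apply: eq_group_avg => g Gg.
by rewrite repr_mxM// mulmxA dotv_repr.
Qed.

End GroupAverage.

(** * The embedding built from averaged tensors and its distortion *)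

Section TensorEmbedding.
Context {R : realType} {gT : finGroupType} {G : {group gT}}.
Variables (V : orthogonal_repr R G) (w2 w3 : R).
Hypotheses (w2_ge0 : 0 <= w2) (w3_ge0 : 0 <= w3).
Local Notation n := (repr_dim V).
Implicit Types x y u v : 'rV[R]_n.

(** The inner product of the vectors formed by the averaged second and third tensor powers, scaled
    by the square roots of [w2] and [w3]. *)
Definition orbit_kernel u v : R := group_avg (G := G) (T := R^o)
  (fun g => w2 * dotv u (v *m V g) ^+ 2 + w3 * dotv u (v *m V g) ^+ 3).

Definition free_norm x : R := Num.sqrt (dotv (free_part x) (free_part x)).
(* [free_dir x = 0] when [free_part x = 0], since [0^-1 = 0]. *)
Definition free_dir x := (free_norm x)^-1 *: free_part x.

Lemma free_norm_ge0 x : 0 <= free_norm x.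
Proof. exact: sqrtr_ge0. Qed.

Lemma free_norm_sqr x : free_norm x ^+ 2 = dotv (free_part x) (free_part x).
Proof. by rewrite sqr_sqrtr// dotv_ge0. Qed.

Lemma free_norm_repr x g : g \in G -> free_norm (x *m V g) = free_norm x.
Proof. by move=> Gg; rewrite /free_norm free_part_repr// dotv_repr. Qed.

Lemma free_dir_repr x g : g \in G -> free_dir (x *m V g) = free_dir x *m V g.
Proof.
by move=> Gg; rewrite /free_dir free_norm_repr// free_part_repr// scalemxAl.
Qed.

Lemma fixed_part_dir x : fixed_part (free_dir x) = 0.
Proof.
rewrite /free_dir /fixed_part -scalemxAl -/(fixed_part _).
by rewrite fixed_part_free scaler0.
Qed.

Lemma dotv_free_dir x : free_norm x != 0 -> dotv (free_dir x) (free_dir x) = 1.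
Proof.
move=> x0; rewrite /free_dir dotvZl dotvZr -free_norm_sqr.
by rewrite expr2 mulKf// mulVf.
Qed.

Lemma free_norm0 x : free_norm x = 0 -> free_part x = 0.
Proof.
move=> x0; apply: euclid_dist_eq0; apply/eqP; rewrite -sqrf_eq0 euclid_dist_sqr.
by rewrite subr0 -free_norm_sqr x0 expr0n.
Qed.

Lemma free_part_dir x : free_part x = free_norm x *: free_dir x.
Proof.
have [x0|x0] := eqVneq (free_norm x) 0; first by rewrite x0 scale0r free_norm0.
by rewrite /free_dir scalerA divff// scale1r.
Qed.

Definition tensor_embedding x :
    l2 R ('I_n + ({ffun 'I_2 -> 'I_n} + {ffun 'I_3 -> 'I_n}))%type :=
  [ffun k => match k with
  | inl i => fixed_part x 0 i
  | inr (inl f) => free_norm x * (Num.sqrt w2 * avg_tensor 2 (free_dir x) f)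
  | inr (inr f) => free_norm x * (Num.sqrt w3 * avg_tensor 3 (free_dir x) f)
  end].

Lemma tensor_embedding_repr x g : g \in G ->
  tensor_embedding (x *m V g) = tensor_embedding x.
Proof.
move=> Gg; rewrite /tensor_embedding fixed_part_repr// free_norm_repr//.
by rewrite free_dir_repr// !avg_tensor_repr.
Qed.

Lemma tensor_embedding_dot x y :
  l2_dot (tensor_embedding x) (tensor_embedding y) =
  dotv (fixed_part x) (fixed_part y)
  + free_norm x * free_norm y * orbit_kernel (free_dir x) (free_dir y).
Proof.
rewrite /l2_dot big_sumType big_sumType/=; congr (_ + _).
  by apply: eq_bigr => i _; rewrite !ffunE.
have T m (w : R) : 0 <= w -> \sum_(f : {ffun 'I_m -> 'I_n})
    (free_norm x * (Num.sqrt w * avg_tensor m (free_dir x) f))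
    * (free_norm y * (Num.sqrt w * avg_tensor m (free_dir y) f)) =
    free_norm x * free_norm y * (w * group_avg (G := G) (T := R^o)
      (fun g => dotv (free_dir x) (free_dir y *m V g) ^+ m)).
  move=> w0; rewrite -avg_tensor_dot -{3}(sqr_sqrtr w0) !mulr_sumr.
  by apply: eq_bigr => f _; ring.
under eq_bigr do rewrite [tensor_embedding _ _]ffunE [X in _ * X]ffunE /=.
rewrite T//.
under [X in _ + X = _]eq_bigr do
  rewrite [tensor_embedding _ _]ffunE [X in _ * X]ffunE /=.
rewrite T//.
rewrite -mulrDr; congr (_ * _); rewrite /orbit_kernel !group_avgE.
rewrite !(mulrCA _ #|G|%:R^-1) -mulrDr; congr (_ * _).
by rewrite big_split/= !mulr_sumr.
Qed.

Definition unit_free u := fixed_part u = 0 /\ dotv u u = 1.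

Hypothesis kernel_diag : forall u, unit_free u -> orbit_kernel u u = 1.

(** The unit diagonal of the kernel makes the embedding preserve norms, so the formula is that of
    [euclid_dist_dir] with the kernel in place of the inner product of directions. *)
Lemma tensor_embedding_dist x y :
  `|tensor_embedding x - tensor_embedding y| ^+ 2 =
  euclid_dist (fixed_part x) (fixed_part y) ^+ 2
  + (free_norm x ^+ 2 + free_norm y ^+ 2
     - 2 * (free_norm x * free_norm y
            * orbit_kernel (free_dir x) (free_dir y))).
Proof.
have N z : l2_dot (tensor_embedding z) (tensor_embedding z) =
    dotv (fixed_part z) (fixed_part z) + free_norm z ^+ 2.
  rewrite tensor_embedding_dot -expr2.
  (* If the free part vanishes, its direction is 0 and not a unit vector, but the kernel is then
     multiplied by 0. *)
  have [->|z0] := eqVneq (free_norm z) 0; first by rewrite expr0n mul0r.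
  rewrite kernel_diag ?mulr1//; split; first exact: fixed_part_dir.
  exact: dotv_free_dir.
rewrite l2_dist_sqr !N tensor_embedding_dot euclid_dist_sqr dotvBB.
ring.
Qed.

Lemma euclid_dist_dir x y : euclid_dist x y ^+ 2 =
  euclid_dist (fixed_part x) (fixed_part y) ^+ 2
  + (free_norm x ^+ 2 + free_norm y ^+ 2
     - 2 * (free_norm x * free_norm y * dotv (free_dir x) (free_dir y))).
Proof.
rewrite euclid_dist_decomp -!free_norm_sqr; congr (_ + (_ - 2 * _)).
by rewrite (free_part_dir x) (free_part_dir y) dotvZl dotvZr mulrA.
Qed.

(** The distance formulas for the embedding and for V differ only in kernel against inner product,
    so both Lipschitz bounds reduce to comparing these on unit vectors of the free part. *)
Lemma kernel_distortion_le (c : R) : 1 <= c ->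
  (forall u v, unit_free u -> unit_free v ->
    exists2 g, g \in G & orbit_kernel u v <= dotv u (v *m V g)) ->
  (forall u v, unit_free u -> unit_free v ->
    c ^+ 2 * dotv u v - orbit_kernel u v <= c ^+ 2 - 1) ->
  (euclidean_distortion (orbit_space V) <= c%:E)%E.
Proof.
move=> c1 Kge Kle; have c0 : 0 <= c by exact: le_trans c1.
have U x : free_norm x != 0 -> unit_free (free_dir x).
  by move=> x0; split; [exact: fixed_part_dir|exact: dotv_free_dir].
apply: (orbit_distortion_le (F := tensor_embedding)) => // [|x y|x y].
- exact: tensor_embedding_repr.
- suff [g Gg Kg] : exists2 g, g \in G &
      free_norm x * free_norm y * orbit_kernel (free_dir x) (free_dir y) <=
      free_norm x * free_norm y * dotv (free_dir x) (free_dir y *m V g).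
    exists g => //; rewrite -ler_sqr ?nnegrE ?euclid_dist_ge0//.
    rewrite tensor_embedding_dist (euclid_dist_dir x) fixed_part_repr//.
    rewrite free_norm_repr// free_dir_repr//.
    by rewrite lerD2l lerD2l lerN2 ler_pM2l.
  have [->|x0] := eqVneq (free_norm x) 0; first by exists 1%g; rewrite ?mul0r.
  have [->|y0] := eqVneq (free_norm y) 0.
    by exists 1%g; rewrite ?mulr0 ?mul0r.
  have [g Gg Kg] := Kge _ _ (U x x0) (U y y0); exists g => //.
  by rewrite ler_wpM2l// mulr_ge0// free_norm_ge0.
- rewrite -ler_sqr ?nnegrE ?mulr_ge0 ?euclid_dist_ge0// exprMn.
  rewrite tensor_embedding_dist (euclid_dist_dir x y).
  have := free_norm_ge0 x; have := free_norm_ge0 y.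
  have c21 : 1 <= c ^+ 2 by rewrite expr_ge1.
  (* c^2 |x - y|^2 - |F x - F y|^2, with F the embedding, is twice this quantity plus the two
     nonnegative ones that follow. *)
  have : 0 <= free_norm x * free_norm y * (c ^+ 2 - 1
      - (c ^+ 2 * dotv (free_dir x) (free_dir y)
         - orbit_kernel (free_dir x) (free_dir y))).
    have [->|x0] := eqVneq (free_norm x) 0; first by rewrite !mul0r.
    have [->|y0] := eqVneq (free_norm y) 0; first by rewrite mulr0 mul0r.
    rewrite !mulr_ge0 ?free_norm_ge0// subr_ge0.
    by apply: Kle; exact: U.
  have : 0 <= (c ^+ 2 - 1) * euclid_dist (fixed_part x) (fixed_part y) ^+ 2.
    by rewrite mulr_ge0 ?sqr_ge0// subr_ge0.
  have : 0 <= (c ^+ 2 - 1) * (free_norm x - free_norm y) ^+ 2.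
    by rewrite mulr_ge0 ?sqr_ge0// subr_ge0.
  move: (free_norm x) (free_norm y) (dotv _ _) (orbit_kernel _ _) => r s a K.
  move: (euclid_dist _ _ ^+ 2) => d2 h1 h2 h3 r0 s0; nra.
Qed.

End TensorEmbedding.

(** * Upper bounds *)

Lemma prime_group_cycle (gT : finGroupType) (G : {group gT}) :
  prime #|G| -> exists2 g, G = <[g]>%g :> {set gT} & #[g]%g = #|G|.
Proof.
by move=> /prime_cyclic/cyclicP[g GE]; exists g => //; rewrite GE.
Qed.

Lemma big_cycle (R : Type) (idx : R) (op : Monoid.com_law idx)
    (gT : finGroupType) (g : gT) (f : gT -> R) :
  \big[op/idx]_(x in <[g]>%g) f x = \big[op/idx]_(i < #[g]%g) f (g ^+ i)%g.
Proof.
pose h (i : 'I_#[g]%g) := (g ^+ i)%g.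
rewrite -[RHS](big_imset (h := h))/=.
  apply: eq_bigl => x; apply/idP/imsetP => [/cyclePmin[i ig ->]|[i _ ->]].
    by exists (Ordinal ig).
  exact: mem_cycle.
move=> i j _ _ /eqP; rewrite eq_expg_mod_order !modn_small// => /eqP.
exact: val_inj.
Qed.

(** * Polynomial inequalities for the kernel of order 3 *)

Section CubicKernel.
Context {R : realFieldType}.
Implicit Types a b c : R.

(* With [a, b, c] the real parts of z, wz, w^2 z for a primitive cube root of
   unity w, this is (3/4)|z|^2 + (1/4)Re z^3, and [(b - c)^2] is 3 (Im z)^2. *)
Definition cubic_kernel a b c :=
  2^-1 * (a ^+ 2 + b ^+ 2 + c ^+ 2) + 3^-1 * (a ^+ 3 + b ^+ 3 + c ^+ 3).

Lemma cubic_kernelE a b c : a + b + c = 0 -> cubic_kernel a b c =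
  (3 * a ^+ 2 + a ^+ 3 + (b - c) ^+ 2 * (1 - a)) / 4.
Proof.
by move=> abc; rewrite /cubic_kernel (_ : c = - a - b); [field|lra].
Qed.

(** The hypotheses put z in the unit disc and in the sector |arg z| <= pi / 3, so that (b - c)^2 is
    at most 3 - 3 a^2 and at most 9 a^2. The kernel is nondecreasing in (b - c)^2 because a <= 1;
    the two bounds cross at a = 1/2, and on each side the smaller one leaves a product of
    nonnegative factors. *)
Lemma cubic_kernel_le a b c : a + b + c = 0 ->
  a ^+ 2 + b ^+ 2 + c ^+ 2 <= 3 / 2 -> b <= a -> c <= a ->
  cubic_kernel a b c <= a.
Proof.
move=> abc q ba ca; rewrite cubic_kernelE// ler_pdivrMr//.
have a0 : 0 <= a by lra.
have D1 : (b - c) ^+ 2 <= 3 - 3 * a ^+ 2.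
  have -> : (b - c) ^+ 2 =
      2 * (a ^+ 2 + b ^+ 2 + c ^+ 2) - 2 * a ^+ 2 - (b + c) ^+ 2 by ring.
  by rewrite (_ : b + c = - a); [rewrite sqrrN|]; lra.
have D2 : (b - c) ^+ 2 <= 9 * a ^+ 2.
  have : 0 <= (a - b) * (a - c) by rewrite mulr_ge0// subr_ge0.
  by rewrite (_ : c = - a - b); [nra|lra].
have a1 : a <= 1.
  rewrite leNgt; apply/negP => a1; have := sqr_ge0 (b - c); nra.
have [a2|a2] := leP (1 / 2) a.
  have : (b - c) ^+ 2 * (1 - a) <= (3 - 3 * a ^+ 2) * (1 - a).
    by rewrite ler_wpM2r// subr_ge0.
  have : 0 <= (1 - a) * (2 * a - 1) * (2 * a + 3) by rewrite !mulr_ge0//; lra.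
  move: ((b - c) ^+ 2) => D; lra.
have : (b - c) ^+ 2 * (1 - a) <= (9 * a ^+ 2) * (1 - a).
  by rewrite ler_wpM2r// subr_ge0.
have : 0 <= 4 * a * (1 - 2 * a) * (1 - a) by rewrite !mulr_ge0//; lra.
move: ((b - c) ^+ 2) => D; lra.
Qed.

Lemma cubic_kernel_le_max a b c : a + b + c = 0 ->
  a ^+ 2 + b ^+ 2 + c ^+ 2 <= 3 / 2 ->
  [\/ cubic_kernel a b c <= a, cubic_kernel a b c <= b
    | cubic_kernel a b c <= c].
Proof.
have swapb x y z : cubic_kernel x y z = cubic_kernel y x z.
  by rewrite /cubic_kernel; ring.
have swapc x y z : cubic_kernel x y z = cubic_kernel z y x.
  by rewrite /cubic_kernel; ring.
move=> abc q; have [ba|/ltW ab] := leP b a.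
  have [ca|/ltW ac] := leP c a; first by apply: Or31; exact: cubic_kernel_le.
  by apply: Or33; rewrite swapc; apply: cubic_kernel_le; lra.
have [cb|/ltW bc] := leP c b.
  by apply: Or32; rewrite swapb; apply: cubic_kernel_le; lra.
by apply: Or33; rewrite swapc; apply: cubic_kernel_le; lra.
Qed.

(** The term in (b - c)^2 has the favourable sign, and the rest is (1 - a)^2 (a + 5) >= 0 up to a
    factor 4. The double root at a = 1 reflects that (3/2)^2 is the derivative of (3 a^2 + a^3) / 4
    there. *)
Lemma cubic_kernel_ge a b c : a ^+ 2 <= 1 -> a + b + c = 0 ->
  (3 / 2) ^+ 2 * a - cubic_kernel a b c <= (3 / 2) ^+ 2 - 1.
Proof.
move=> a2 abc; rewrite cubic_kernelE//.
have /andP[an1 a1] : -1 <= a <= 1 by apply/andP; split; nra.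
have : 0 <= (b - c) ^+ 2 * (1 - a) by rewrite mulr_ge0 ?sqr_ge0// subr_ge0.
have : 0 <= (1 - a) ^+ 2 * (a + 5) by rewrite mulr_ge0 ?sqr_ge0//; lra.
move: ((b - c) ^+ 2) => D; lra.
Qed.

End CubicKernel.

(** * Distortion bounds for groups of order 1, 2 and 3 *)

Section Kernels.
Context {R : realType} {gT : finGroupType} {G : {group gT}}.
Variable V : orthogonal_repr R G.
Implicit Types u v : 'rV[R]_(repr_dim V).

Lemma dotv_unit_norm_le1 u v : dotv u u = 1 -> dotv v v = 1 ->
  dotv u v ^+ 2 <= 1.
Proof.
by move=> u1 v1; rewrite (le_trans (dotv_cauchy_schwarz u v))// u1 v1 mulr1.
Qed.

(** The sum of [v *m V g] over the group is #|G| times the fixed part of [v]. *)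
Lemma sum_dotv_orbit u v : fixed_part v = 0 ->
  \sum_(g in G) dotv u (v *m V g) = 0.
Proof.
move=> v0; have L : linear (dotv u : _ -> R^o).
  by move=> a x y; rewrite dotvDr dotvZr.
pose D : {linear 'rV[R]_(repr_dim V) -> R^o} := HB.pack (dotv u : _ -> R^o)
  (GRing.isLinear.Build _ _ _ _ _ L).
transitivity (D (\sum_(g in G) v *m V g)); first by rewrite linear_sum.
rewrite -mulmx_sumr.
have -> : \sum_(g in G) V g = #|G|%:R *: fixed_proj V.
  by rewrite /fixed_proj scalerA divff ?scale1r// card_group_neq0.
by rewrite -scalemxAr -/(fixed_part v) v0 scaler0 linear0.
Qed.

(** Every vector is fixed, so there are no unit free vectors and all conditions on the zero kernel
    are vacuous. *)
Lemma trivial_group_distortion_le : #|G| = 1%N ->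
  (euclidean_distortion (orbit_space V) <= 1%:E)%E.
Proof.
move=> G1; have S (f : gT -> R) : \sum_(x in G) f x = f 1%g.
  by rewrite (card1_trivg G1) big_set1.
have U u : ~ unit_free u.
  move=> [u0 uu]; have := sum_dotv_orbit u u0.
  by rewrite S repr_mx1 mulmx1 uu => /eqP; rewrite oner_eq0.
by apply: (kernel_distortion_le (w2 := 0) (w3 := 0)) => // [u|u v|u v] /U.
Qed.

(** The generator acts as -1 on the free part, so the kernel is t^2 with t = <u, v>. It remains that
    t^2 <= max(t, -t) for |t| <= 1 and that 2 t - t^2 <= 1. *)
Lemma order2_distortion_le : #|G| = 2%N ->
  (euclidean_distortion (orbit_space V) <= (Num.sqrt 2)%:E)%E.
Proof.
move=> G2; have [g GE og] : exists2 g, G = <[g]>%g :> {set gT} & #[g]%g = #|G|.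
  by apply: prime_group_cycle; rewrite G2.
have S (f : gT -> R) : \sum_(x in G) f x = f 1%g + f g.
  by rewrite GE big_cycle og G2 big_ord_recl big_ord1/= expg1.
have D u v : unit_free v -> dotv u (v *m V g) = - dotv u v.
  move=> [v0 _]; have /eqP := sum_dotv_orbit u v0; rewrite S repr_mx1 mulmx1.
  by rewrite addrC addr_eq0 => /eqP.
have K u v : unit_free v -> orbit_kernel 1 0 u v = dotv u v ^+ 2.
  move=> v0; rewrite /orbit_kernel group_avgE S D// repr_mx1 mulmx1 G2.
  by field.
have s2 : Num.sqrt 2 ^+ 2 = 2 :> R by rewrite sqr_sqrtr.
apply: (kernel_distortion_le (w2 := 1) (w3 := 0)) => //.
- by move=> u u0; rewrite K// u0.2 expr1n.
- by rewrite -[leLHS]sqrtr1 ler_sqrt ?ler1n.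
- move=> u v u0 v0; have := dotv_unit_norm_le1 u0.2 v0.2; rewrite K//.
  have [a0|a0] := leP 0 (dotv u v) => a1.
    by exists 1%g => //; rewrite repr_mx1 mulmx1; nra.
  by exists g; rewrite ?GE ?cycle_id// D//; nra.
- move=> u v u0 v0; rewrite K// s2; have := sqr_ge0 (dotv u v - 1).
  by rewrite sqrrB expr1n mulr1; lra.
Qed.

(** Averaging over three elements turns the weights 3/2 and 1 into the coefficients 1/2 and 1/3 of
    [cubic_kernel], taken at the products of [u] with the orbit of [v]. These sum to zero, and their
    squares to at most 3/2. *)
Lemma order3_distortion_le : #|G| = 3%N ->
  (euclidean_distortion (orbit_space V) <= (3 / 2)%:E)%E.
Proof.
move=> G3; have [g GE og] : exists2 g, G = <[g]>%g :> {set gT} & #[g]%g = #|G|.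
  by apply: prime_group_cycle; rewrite G3.
have Gg : g \in G by rewrite GE cycle_id.
have S (f : gT -> R) : \sum_(x in G) f x = f 1%g + f g + f (g * g)%g.
  by rewrite GE big_cycle og G3 !big_ord_recl big_ord0/= addr0 addrA.
have S0 u v : unit_free v ->
    dotv u v + dotv u (v *m V g) + dotv u (v *m V (g * g)%g) = 0.
  by move=> [v0 _]; have := sum_dotv_orbit u v0; rewrite S repr_mx1 mulmx1.
have K u v : orbit_kernel (3 / 2) 1 u v =
    cubic_kernel (dotv u v) (dotv u (v *m V g)) (dotv u (v *m V (g * g)%g)).
  rewrite /orbit_kernel group_avgE S repr_mx1 mulmx1 G3 /cubic_kernel.
  by field.
have ggg : (g * g * g = 1)%g.
  by rewrite -mulgA -[RHS](expg_order g) og G3 !expgS expg0 mulg1.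
have V3 u : u *m V (g * g)%g *m V g = u.
  by rewrite -mulmxA -repr_mxM ?groupM// ggg repr_mx1 mulmx1.
have Vgg u : u *m V (g * g)%g = u *m V g *m V g.
  by rewrite repr_mxM// mulmxA.
(* The two products agree since [g * g] is the inverse of [g], and together with <u, u> = 1 they sum
   to zero. *)
have E1 u : unit_free u -> dotv u (u *m V g) = - 2^-1 /\
    dotv u (u *m V (g * g)%g) = - 2^-1.
  move=> u0; have := S0 u u u0.
  have -> : dotv u (u *m V (g * g)%g) = dotv u (u *m V g).
    by rewrite -(dotv_repr u _ Gg) V3 dotvC.
  by rewrite u0.2 => E; split; lra.
(* That is, |z| <= 1: Cauchy-Schwarz for the hermitian product. *)
have Q u v : unit_free u -> unit_free v ->
    dotv u v ^+ 2 + dotv u (v *m V g) ^+ 2 + dotv u (v *m V (g * g)%g) ^+ 2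
    <= 3 / 2.
  move=> u0 v0; have := S0 u v v0; have [e1 e2] := E1 v v0.
  set a := dotv u v; set b := dotv u (v *m V g).
  set c := dotv u (v *m V (g * g)%g) => abc.
  (* This is 3/2 times the orthogonal projection of [u] onto the plane spanned by the orbit of [v].
     Cauchy-Schwarz then reads q^2 <= (3/2) q for the sum q of the three squares. *)
  pose w := a *: v + b *: (v *m V g) + c *: (v *m V (g * g)%g).
  have := dotv_cauchy_schwarz u w.
  have -> : dotv u w = a ^+ 2 + b ^+ 2 + c ^+ 2.
    by rewrite /w !dotvDr !dotvZr !expr2.
  have -> : dotv w w = 3 / 2 * (a ^+ 2 + b ^+ 2 + c ^+ 2).
    have e3 : dotv (v *m V g) (v *m V (g * g)%g) = - 2^-1.
      by rewrite Vgg dotv_repr// e1.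
    rewrite /w !(dotvDl, dotvDr, dotvZl, dotvZr).
    rewrite (dotvC _ v) (dotvC (v *m V (g * g)%g) v).
    rewrite (dotvC (v *m V (g * g)%g) (v *m V g)) !dotv_repr ?groupM//.
    rewrite v0.2 e1 e2 e3; have -> : c = - a - b by lra.
    by field.
  rewrite u0.2 mul1r; have : 0 <= a ^+ 2 + b ^+ 2 + c ^+ 2.
    by rewrite !addr_ge0 ?sqr_ge0.
  move: (_ + _ + _) => q q0 qq; have [->|qN0] := eqVneq q 0; first by lra.
  by rewrite -(ler_pM2r (_ : 0 < q)) -?expr2// lt_neqAle eq_sym qN0.
apply: (kernel_distortion_le (w2 := 3 / 2) (w3 := 1)) => //.
- move=> u u0; rewrite K u0.2; have [-> ->] := E1 u u0.
  by rewrite /cubic_kernel; field.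
- lra.
- move=> u v u0 v0; rewrite K.
  have [] := cubic_kernel_le_max (S0 u v v0) (Q u v u0 v0).
  + by exists 1%g; rewrite // repr_mx1 mulmx1.
  + by exists g.
  + by exists (g * g)%g; rewrite // groupM.
- move=> u v u0 v0; have := S0 u v v0; rewrite K.
  have := dotv_unit_norm_le1 u0.2 v0.2; exact: cubic_kernel_ge.
Qed.

End Kernels.

(** * Lower bounds *)

Section Rotation.
Context {R : realType}.
Implicit Types a b : R.

Definition circle_pt a : 'rV[R]_2 :=
  \row_(j < 2) if j == 0 then cos a else sin a.

(** The transpose of the usual rotation matrix, since it acts on row vectors from the right. *)
Definition rotation a : 'M[R]_2 :=
  \matrix_(i < 2, j < 2)
    if i == 0 then (if j == 0 then cos a else sin a)
    else (if j == 0 then - sin a else cos a).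

Lemma circle_pt_rotation a b : circle_pt a *m rotation b = circle_pt (a + b).
Proof.
apply/rowP => j; rewrite !mxE !big_ord_recl big_ord0 !mxE/= addr0.
by case: (j == 0); rewrite ?cosD ?sinD; ring.
Qed.

Lemma rotationD a b : rotation (a + b) = rotation a *m rotation b.
Proof.
apply/matrixP => i j; rewrite !mxE !big_ord_recl big_ord0 !mxE/= addr0.
by case: (i == 0); case: (j == 0); rewrite ?cosD ?sinD; ring.
Qed.

Lemma rotation0 : rotation 0 = 1%:M.
Proof.
apply/matrixP => i j; rewrite !mxE sin0 cos0 oppr0.
by case: i => -[|[|//]] i2; case: j => -[|[|//]] j2.
Qed.

Lemma rotation_orthogonal a : rotation a *m (rotation a)^T = 1%:M.
Proof.
have -> : (rotation a)^T = rotation (- a).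
  apply/matrixP => i j; rewrite !mxE sinN cosN opprK.
  by case: i => -[|[|//]] i2; case: j => -[|[|//]] j2.
by rewrite -rotationD subrr rotation0.
Qed.

Lemma rotation_periodic (n : nat) a : rotation (a + pi *+ 2 *+ n) = rotation a.
Proof.
apply/matrixP => i j; rewrite !mxE.
by rewrite (periodicn (@cosD2pi R)) (periodicn (@sinD2pi R)).
Qed.

Lemma euclid_dist_circle a b :
  euclid_dist (circle_pt a) (circle_pt b) ^+ 2 = 2 * (1 - cos (a - b)).
Proof.
rewrite euclid_dist_sqr /dotv !big_ord_recl big_ord0 !mxE/= cosB.
transitivity (cos a ^+ 2 + sin a ^+ 2 + (cos b ^+ 2 + sin b ^+ 2)
  - 2 * (cos a * cos b + sin a * sin b)); first by ring.
by rewrite !cos2Dsin2; ring.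
Qed.

End Rotation.

(** * A cyclic group rotating the plane *)

Section RotationRepr.
Context {R : realType} {gT : finGroupType}.
Variable g : gT.
Local Notation r := #[g]%g.

(** A discrete logarithm obtained by choice: on the cycle it is meaningful only modulo the order of
    [g], and outside it is 0. *)
Definition cycle_log (x : gT) : nat := xget 0%N [set k | x = g ^+ k]%g.

Lemma cycle_logK x : x \in <[g]>%g -> (g ^+ cycle_log x)%g = x.
Proof.
move=> /cyclePmin[k _ xk]; rewrite /cycle_log.
by case: xgetP => [i _ <-//|/(_ k)/=]; rewrite xk.
Qed.

Definition cycle_rotation (x : gT) : 'M[R]_2 :=
  rotation (pi *+ 2 / r%:R * (cycle_log x)%:R).

(** The rotation depends on the exponent only modulo [r], so the choice made by [cycle_log] is
    harmless. *)
Lemma cycle_rotationE k :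
  cycle_rotation (g ^+ k)%g = rotation (pi *+ 2 / r%:R * k%:R).
Proof.
have r0 : r%:R != 0 :> R by rewrite pnatr_eq0 -lt0n order_gt0.
have E i : rotation (pi *+ 2 / r%:R * i%:R) =
    rotation (pi *+ 2 / r%:R * (i %% r)%:R) :> 'M[R]_2.
  rewrite {1}(divn_eq i r) natrD natrM mulrDr addrC.
  rewrite (_ : _ * (_ * _) = pi *+ 2 *+ (i %/ r)) ?rotation_periodic//.
  by rewrite mulrCA divfK// mulr_natl.
rewrite /cycle_rotation E [RHS]E; congr (rotation (_ * _%:R)).
apply/eqP; rewrite -eq_expg_mod_order cycle_logK//; exact: mem_cycle.
Qed.

Lemma cycle_rotation_repr : mx_repr <[g]>%g cycle_rotation.
Proof.
split=> [|x y /cyclePmin[i _ ->] /cyclePmin[j _ ->]].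
  by rewrite -(expg0 g) cycle_rotationE mulr0 rotation0.
by rewrite -expgD !cycle_rotationE natrD mulrDr rotationD.
Qed.

Definition rotation_repr : orthogonal_repr R <[g]>%G :=
  OrthogonalRepr (ortho_repr := MxRepresentation cycle_rotation_repr)
    (fun x _ => rotation_orthogonal _).

Local Notation V := rotation_repr.
Local Notation P a := (@orbit_of R gT <[g]>%G V (circle_pt a)).

Lemma mdist_circle_le (a b : R) :
  mdist (P a) (P b) ^+ 2 <= 2 * (1 - cos (a - b)).
Proof.
rewrite -euclid_dist_circle ler_sqr ?nnegrE ?mdist_ge0 ?euclid_dist_ge0//.
have := @mdist_orbit_le R gT <[g]>%G V (circle_pt a) (circle_pt b) _ _
  (group1 _) (group1 _).
by rewrite repr_mx1 !mulmx1.
Qed.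

Lemma orbit_circle_period (a : R) : P (a + pi *+ 2 / r%:R) = P a.
Proof.
apply: mdist_positivity; apply/eqP; rewrite eq_le mdist_ge0 andbT.
have := @mdist_orbit_le R gT <[g]>%G V (circle_pt (a + pi *+ 2 / r%:R))
  (circle_pt a) _ _ (group1 _) (cycle_id g).
have -> : V g = rotation (pi *+ 2 / r%:R).
  by have := cycle_rotationE 1; rewrite expg1 mulr1.
by rewrite repr_mx1 mulmx1 circle_pt_rotation euclid_distxx.
Qed.

(* No point in the orbit of angle [a] is closer to angle [a + pi / r] than
   [a] itself. *)
Hypothesis far : forall k, (k < r)%N ->
  cos ((1 - 2 * k%:R) * (pi / r%:R)) <= cos (pi / r%:R) :> R.

Lemma mdist_circle_ge (a : R) :
  2 * (1 - cos (pi / r%:R)) <= mdist (P (a + pi / r%:R)) (P a) ^+ 2.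
Proof.
rewrite -[leLHS]sqr_sqrtr; last first.
  by rewrite mulr_ge0// subr_ge0 cos_le1.
rewrite ler_sqr ?nnegrE ?sqrtr_ge0 ?mdist_ge0//.
apply: mdist_orbit_ge => x /cyclePmin[k kr ->].
rewrite -(ger0_norm (euclid_dist_ge0 _ _)) -sqrtr_sqr ler_wsqrtr//.
rewrite [repr_mx _ _]cycle_rotationE circle_pt_rotation euclid_dist_circle.
rewrite ler_pM2l// lerD2l lerN2; apply: le_trans (far kr).
rewrite le_eqVlt; apply/orP; left; apply/eqP; congr cos.
rewrite opprD addrACA subrr add0r; ring.
Qed.

(* The curve [i |-> f (P (eta * i))] closes up after [2 * m] steps, so that
   [d i.+1 - d i] is a difference of two increments of length at most [be] times
   that of a step on the circle. *)
Lemma rotation_wirtinger (H : hilbertType R) (f : orbit_space V -> H)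
    (al be : R) (m : nat) : (2 <= m)%N -> 0 <= al ->
  (forall A B, al * mdist A B <= `|f A - f B|) ->
  (forall A B, `|f A - f B| <= be * mdist A B) ->
  (1 - cos (pi / m%:R)) * (1 - cos (pi / r%:R)) * al ^+ 2
  <= 2 * (1 - cos (pi / (r * m)%:R)) * be ^+ 2.
Proof.
move=> m2 al0 fal fbe; pose eta : R := pi / (r * m)%:R.
have r0 : r%:R != 0 :> R by rewrite pnatr_eq0 -lt0n order_gt0.
have m0 : m%:R != 0 :> R by rewrite pnatr_eq0 -lt0n ltnW.
have eta_m : eta * m%:R = pi / r%:R.
  by rewrite /eta natrM; field; rewrite r0 m0.
pose p i := f (P (eta * i%:R)); pose d i := p (i + m)%N - p i.
have step i : `|p i.+1 - p i| ^+ 2 <= be ^+ 2 * (2 * (1 - cos eta)).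
  apply: (@le_trans _ _
      ((be * mdist (P (eta * i.+1%:R)) (P (eta * i%:R))) ^+ 2)).
    by rewrite ler_sqr ?nnegrE ?(le_trans _ (fbe _ _)).
  rewrite exprMn ler_wpM2l ?sqr_ge0//; apply: le_trans (mdist_circle_le _ _) _.
  by rewrite -mulrBr -(natr1 i) [i%:R + 1]addrC addrK mulr1.
(* The lower constant at angle pi / r bounds |d i|^2 from below. The factor 4 comes from |x - y|^2
   <= 2 (|x|^2 + |y|^2) applied to two increments of equal bound. *)
have := @wirtinger_antiperiodic R H m d (al ^+ 2 * (2 * (1 - cos (pi / r%:R))))
  (4 * (be ^+ 2 * (2 * (1 - cos eta)))) m2.
rewrite -/eta => W; suff : 2 * (1 - cos (pi / m%:R)) *
   (al ^+ 2 * (2 * (1 - cos (pi / r%:R)))) <=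
   4 * (be ^+ 2 * (2 * (1 - cos eta))) by lra.
apply: W => [|i _|i _].
(* Since m steps of [eta] make pi / r, 2 m steps make a full period, and d m = p (2 m) - p m = p 0 -
   p m. *)
- rewrite /d opprB add0n; congr (_ - _); rewrite /p mulr0.
  rewrite -(orbit_circle_period 0) add0r; congr (f (P _)).
  by rewrite natrD mulrDr eta_m (mulr2n pi) (mulrDl pi).
- apply: (@le_trans _ _
      ((al * mdist (P (eta * (i + m)%:R)) (P (eta * i%:R))) ^+ 2)).
    rewrite exprMn ler_wpM2l ?sqr_ge0// (natrD _ i m) (mulrDr eta) eta_m.
    exact: mdist_circle_ge.
  by rewrite ler_sqr ?nnegrE ?mulr_ge0 ?mdist_ge0// fal.
- rewrite /d addSn.
  have -> : p (i + m).+1 - p i.+1 - (p (i + m)%N - p i) =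
      (p (i + m).+1 - p (i + m)%N) - (p i.+1 - p i).
    by rewrite !opprB addrACA [- _ + _]addrC addrACA.
  apply: (@le_trans _ _ (2 * (`|p (i + m).+1 - p (i + m)%N| ^+ 2 +
      `|p i.+1 - p i| ^+ 2))).
    move: (p (i + m).+1 - p (i + m)%N) (p i.+1 - p i) => x y.
    by have := sqr_ge0 `|x + y|; rewrite normB_sqr normD_sqr; lra.
  by have := step i; have := step (i + m)%N; lra.
Qed.

Lemma orbit_circle_neq : (1 < r)%N ->
  exists A B : orbit_space V, A <> B.
Proof.
move=> r1; exists (P (0 + pi / r%:R)), (P 0) => E.
have := mdist_circle_ge 0; rewrite E mdistxx expr0n/=.
rewrite pmulr_rle0// subr_le0 => c1.
have : cos (pi / r%:R) < cos 0 :> R.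
  rewrite ltr_cos ?in_itv/= ?lexx ?pi_ge0 ?divr_ge0 ?pi_ge0 ?divr_gt0 ?pi_gt0//.
    by rewrite ltr0n ltnW.
  by rewrite ler_pdivrMr ?ltr0n 1?ltnW// ler_peMr ?pi_ge0// ler1n ltnW.
by rewrite cos0 ltNge c1.
Qed.

(** [A] and [B] stand for the squares of the lower and upper constants; all that is left to each
    order is to let [m] tend to infinity. *)
Lemma rotation_distortion_ge (c : R) : 0 <= c -> (1 < r)%N ->
  (forall A B : R, (forall m, (2 <= m)%N ->
    (1 - cos (pi / m%:R)) * (1 - cos (pi / r%:R)) * A
    <= 2 * (1 - cos (pi / (r * m)%:R)) * B) -> c ^+ 2 * A <= B) ->
  (c%:E <= euclidean_distortion (orbit_space V))%E.
Proof.
move=> c0 r1 cP; have [A0 [B0 AB0]] := orbit_circle_neq r1.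
apply: euclidean_distortion_ge; first by exists A0, B0.
move=> H f al be al0 fal fbe.
have be0 : 0 <= be.
  have d0 : 0 < mdist A0 B0 by rewrite mdist_gt0; exact/eqP.
  by rewrite -(pmulr_lge0 _ d0) (le_trans _ (fbe _ _)).
rewrite -ler_sqr ?nnegrE ?mulr_ge0 ?(ltW al0)// exprMn; apply: cP => m m2.
exact: rotation_wirtinger (ltW al0) fal fbe.
Qed.

End RotationRepr.

(** * Limits of the Wirtinger bound for orders 2 and 3 *)

Section LowerBounds.
Context {R : realType}.

Lemma cos_mulr3n (x : R) : cos (3 * x) = 4 * cos x ^+ 3 - 3 * cos x.
Proof.
have -> : 3 * x = x + (x + x) by ring.
rewrite cosD sinD cosD.
transitivity (cos x ^+ 3 - 3 * cos x * sin x ^+ 2); first by ring.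
by rewrite sin2cos2; ring.
Qed.

(** By the triple angle formula the cosine is a root of 4 c^3 - 3 c + 1 = (c + 1)(2 c - 1)^2, and it
    is positive. *)
Lemma cos_pi3 : cos (pi / 3) = 1 / 2 :> R.
Proof.
have pi0 := @pi_gt0 R.
have c0 : 0 < cos (pi / 3) :> R.
  by apply: cos_gt0_pihalf; apply/andP; split; lra.
have := cos_mulr3n (pi / 3); rewrite mulrC divfK ?pnatr_eq0// cospi.
set c := cos _ in c0 * => E.
have : (c + 1) * (2 * c - 1) ^+ 2 = 0.
  by rewrite -[RHS](subrr (-1)) {2}E; ring.
move=> /eqP; rewrite mulf_eq0 sqrf_eq0 => /orP[|] /eqP; lra.
Qed.

Lemma cos_limit (phi : R -> R) (q b : R) : {for 1, continuous phi} ->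
  (forall m : nat, (2 <= m)%N -> phi (cos (q / m%:R)) <= b) -> phi 1 <= b.
Proof.
move=> phi1 phib.
suff cv : phi (cos (q * n.+1%:R^-1)) @[n --> \oo] --> phi 1.
  apply: (cvgr_to_le cv); near=> n; apply: phib; rewrite ltnS.
  by near: n; exists 1%N.
apply: continuous_cvg => //; rewrite -[X in _ --> X]cos0.
apply: continuous_cvg; first exact: continuous_cos.
rewrite -[X in _ --> X](mulr0 q); apply: cvgM; first exact: cvg_cst.
exact: (@cvg_harmonic R).
Unshelve. all: by end_near. Qed.

Lemma cos_lt1 (x : R) : 0 < x <= pi -> cos x < 1.
Proof.
move=> /andP[x0 xpi]; rewrite -cos0 ltr_cos// in_itv/= ?lexx ?pi_ge0//.
by rewrite xpi ltW.
Qed.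

(** With c = cos (pi / (2 m)), 1 - cos (pi / m) = 2 (1 - c)(1 + c). Cancelling 2 (1 - c) leaves (1 +
    c) A <= B, whose limit is 2 A <= B. *)
Lemma order2_distortion_ge (gT : finGroupType) (g : gT) : #[g]%g = 2%N ->
  ((Num.sqrt 2)%:E <=
    euclidean_distortion (orbit_space (@rotation_repr R gT g)))%E.
Proof.
move=> g2.
have far k : (k < #[g]%g)%N ->
    cos ((1 - 2 * k%:R) * (pi / #[g]%g%:R)) <= cos (pi / #[g]%g%:R) :> R.
  rewrite g2; case: k => [|[|//]] _; first by rewrite mulr0 subr0 mul1r.
  by rewrite (_ : 1 - 2 * 1 = -1 :> R) ?mulN1r ?cosN//; ring.
apply: (rotation_distortion_ge far); rewrite ?sqrtr_ge0 ?g2// => A B W.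
rewrite sqr_sqrtr//.
rewrite -[2](_ : 1 + 1 = _ :> R)//.
apply: (@cos_limit (fun x => (1 + x) * A) (pi / 2)) => [|m m2].
  apply: cvgM; last exact: cvg_cst.
  by apply: cvgD; [exact: cvg_cst|exact: cvg_id].
have m0 : 0 < m%:R :> R by rewrite ltr0n ltnW.
have := W m m2; rewrite cos_pihalf natrM.
have -> : pi / (2 * m%:R) = pi / 2 / m%:R :> R by rewrite invfM mulrA.
have -> : pi / m%:R = (pi / 2 / m%:R) *+ 2 :> R.
  by rewrite -[RHS]mulr_natl; field; rewrite gt_eqF.
rewrite cos_mulr2n.
have : cos (pi / 2 / m%:R) < 1 :> R.
  rewrite cos_lt1// !divr_gt0 ?pi_gt0//= -mulrA ler_piMr ?pi_ge0//.
  rewrite -invfM invf_le1 ?mulr_gt0// (le_trans (_ : 1 <= 2 * 1))//.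
    by lra.
  by rewrite ler_pM2l// ler1n ltnW.
set c := cos _ => c1 E.
rewrite -(ler_pM2l (_ : 0 < 2 * (1 - c))) ?mulr_gt0 ?subr_gt0//.
apply: le_trans E; rewrite le_eqVlt; apply/orP; left; apply/eqP; ring.
Qed.

(** With c = cos (pi / (3 m)), 1 - cos (pi / m) = (1 - c)(1 + 2 c)^2. Cancelling 2 (1 - c) leaves (1
    + 2 c)^2 / 4 A <= B, whose limit is (9 / 4) A <= B. *)
Lemma order3_distortion_ge (gT : finGroupType) (g : gT) : #[g]%g = 3%N ->
  ((3 / 2)%:E <=
    euclidean_distortion (orbit_space (@rotation_repr R gT g)))%E.
Proof.
move=> g3.
have far k : (k < #[g]%g)%N ->
    cos ((1 - 2 * k%:R) * (pi / #[g]%g%:R)) <= cos (pi / #[g]%g%:R) :> R.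
  rewrite g3; case: k => [|[|[|//]]] _; first by rewrite mulr0 subr0 mul1r.
    by rewrite (_ : 1 - 2 * 1 = -1 :> R) ?mulN1r ?cosN//; ring.
  rewrite (_ : _ * (pi / 3) = - pi); last by field.
  by rewrite cosN cospi cos_geN1.
apply: (rotation_distortion_ge far); rewrite ?g3// => A B W.
have -> : (3 / 2) ^+ 2 = ((1 + 2 * 1) * (1 + 2 * 1)) / 4 :> R by field.
apply: (@cos_limit (fun x => (1 + 2 * x) * (1 + 2 * x) / 4 * A) (pi / 3))
    => [|m m2].
  have C : (1 + 2 * x : R) @[x --> (1 : R)] --> (1 + 2 * 1 : R).
    apply: cvgD; first exact: cvg_cst.
    by apply: cvgM; [exact: cvg_cst|exact: cvg_id].
  apply: cvgM; last exact: cvg_cst.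
  by apply: cvgM; [exact: cvgM|exact: cvg_cst].
have m0 : 0 < m%:R :> R by rewrite ltr0n ltnW.
have := W m m2; rewrite cos_pi3 natrM.
have -> : pi / (3 * m%:R) = pi / 3 / m%:R :> R by rewrite invfM mulrA.
have -> : pi / m%:R = 3 * (pi / 3 / m%:R) :> R by field; rewrite gt_eqF.
rewrite cos_mulr3n.
have : cos (pi / 3 / m%:R) < 1 :> R.
  rewrite cos_lt1// !divr_gt0 ?pi_gt0//= -mulrA ler_piMr ?pi_ge0//.
  rewrite -invfM invf_le1 ?mulr_gt0// (le_trans (_ : 1 <= 3 * 1))//.
    by lra.
  by rewrite ler_pM2l// ler1n ltnW.
set c := cos _ => c1 E.
rewrite -(ler_pM2l (_ : 0 < 2 * (1 - c))) ?mulr_gt0 ?subr_gt0//.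
by apply: le_trans E; rewrite le_eqVlt; apply/orP; left; apply/eqP; field.
Qed.

End LowerBounds.

(** * The contortion of groups of order at most 3 *)

Lemma zero_repr_proof (R : realType) (gT : finGroupType) (G : {group gT}) :
  mx_repr G (fun _ : gT => 1%:M : 'M[R]_0).
Proof. by split=> // x y _ _; rewrite mulmx1. Qed.

(** Its orbit space is a single point, of distortion 1 by convention; this gives the lower bound for
    the trivial group. *)
Definition zero_repr (R : realType) (gT : finGroupType) (G : {group gT}) :
    orthogonal_repr R G :=
  OrthogonalRepr (ortho_repr := MxRepresentation (zero_repr_proof R G))
    (fun g _ => etrans (flatmx0 _) (esym (flatmx0 _))).

Lemma zero_repr_distortion (R : realType) (gT : finGroupType) (G : {group gT}) :
  euclidean_distortion (orbit_space (zero_repr R G)) = 1%E.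
Proof.
rewrite /euclidean_distortion; case: asboolP => // -[] A B.
have [x ->] := orbit_ofP A; have [y ->] := orbit_ofP B.
by congr orbit_of; apply/rowP => -[].
Qed.

Lemma contortion_eq (R : realType) (gT : finGroupType) (G : {group gT}) c :
  (forall V : orthogonal_repr R G,
    euclidean_distortion (orbit_space V) <= c)%E ->
  (exists V : orthogonal_repr R G,
    c <= euclidean_distortion (orbit_space V))%E ->
  euclidean_contortion R G = c.
Proof.
move=> Vc [V cV]; apply/eqP; rewrite eq_le; apply/andP; split.
  by apply: ge_ereal_sup => _ [W _ <-].
by apply: le_trans cV _; apply: ereal_sup_ubound; exists V.
Qed.

Theorem lemma8 (R : realType) (gT : finGroupType) (G : {group gT})
    (hG : (#|G| <= 3)%N) :
  euclidean_contortion R G =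
    (if #|G| == 1%N then 1
     else if #|G| == 2%N then Num.sqrt 2
     else 3 / 2 : R)%:E.
Proof.
have := cardG_gt0 G; move: hG; case G1 : #|G| => [|[|[|[|//]]]] _ _ //=.
- apply: contortion_eq => [V|]; first exact: trivial_group_distortion_le.
  by exists (zero_repr R G); rewrite zero_repr_distortion.
- apply: contortion_eq => [V|]; first exact: order2_distortion_le.
  have [g GE og] : exists2 g, G = <[g]>%g :> {set gT} & #[g]%g = #|G|.
    by apply: prime_group_cycle; rewrite G1.
  rewrite (_ : G = <[g]>%G); last exact/val_inj.
  by exists (rotation_repr g); apply: order2_distortion_ge; rewrite og.
- apply: contortion_eq => [V|]; first exact: order3_distortion_le.
  have [g GE og] : exists2 g, G = <[g]>%g :> {set gT} & #[g]%g = #|G|.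
    by apply: prime_group_cycle; rewrite G1.
  rewrite (_ : G = <[g]>%G); last exact/val_inj.
  by exists (rotation_repr g); apply: order3_distortion_ge; rewrite og.
Qed.
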